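(* Let $\mathcal{N}^{A'\to BE}$ be a quantum wiretap channel with qubit input $A'$, let $z\mapsto\rho_z^{A'}$ ($z\in\{0,1\}$) be a choice of two input states, let $W_{A,B}$ and $W_{P,B}$ be the associated amplitude and phase channels to Bob, and let $0<\beta<1/2$. If $$\sqrt{F(W_{A,B})}+\sqrt{F(W_{P,B})}<1,$$ then the private polar coding scheme has a vanishing secret key rate; that is, if for $N=2^n$ the set $\mathcal{B}$ denotes the inputs of the scheme of block length $N$ that are assigned secret-key bits, then $\lim_{N=2^n\to\infty}|\mathcal{B}|/N=0$.
   Context: Basic quantities. A binary-input classical-quantum (cq) channel $W:x\mapsto\rho_x$ assigns to each bit $x\in\{0,1\}$ a density operator $\rho_x$. Its fidelity is $F(W)=\|\sqrt{\rho_0}\sqrt{\rho_1}\|_1^2$. Wiretap channel. A quantum wiretap channel $\mathcal{N}^{A'\to BE}$ is a completely positive trace-preserving map from a qubit $A'$ to systems $B$ (legitimate receiver, Bob) and $E$ (wiretapper); $\mathcal{N}^{A'\to B}=\mathrm{Tr}_E\circ\mathcal{N}^{A'\to BE}$. Let $U_{\mathcal N}^{A'\to BES_2}$ be an isometric extension of $\mathcal{N}^{A'\to BE}$ with environment $S_2$. Fix input states $\rho_z^{A'}$, $z\in\{0,1\}$, with purifications $|\psi_z\rangle^{A'S_1}$. Amplitude channel to Bob: $W_{A,B}:z\mapsto\mathcal{N}^{A'\to B}(\rho_z^{A'})$. Phase channel to Bob: with $|\varphi\rangle^{CA'S_1}=\frac1{\sqrt2}\sum_{z}|z\rangle^C|\psi_z\rangle^{A'S_1}$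 and $Z$ the Pauli phase operator, $W_{P,B}:x\mapsto\omega_x^{BCS_1S_2}=\mathrm{Tr}_E\{U_{\mathcal N}(Z^x)^C|\varphi\rangle\langle\varphi|(Z^x)^C U_{\mathcal N}^\dagger\}$. Synthesized channels. Let $N=2^n$ and let $G_N$ be Arikan's $N\times N$ encoding matrix over $\mathbb{F}_2$, $G_N=R_NK^{\otimes n}$ with $K=\begin{pmatrix}1&0\\1&1\end{pmatrix}$ and $R_N$ the bit-reversal permutation matrix; bit strings are row vectors. For a cq channel $W:x\mapsto\rho_x$ write $\rho_{x^N}=\rho_{x_1}\otimes\cdots\otimes\rho_{x_N}$. The $i$-th synthesized amplitude channel $W_{A,B,N}^{(i)}$ (with $\rho_x$ the outputs of $W_{A,B}$) is $$u_i\mapsto\sum_{u_1^{i-1}}\frac1{2^{i-1}}|u_1^{i-1}\rangle\langle u_1^{i-1}|\otimes\sum_{u_{i+1}^N}\frac1{2^{N-i}}\rho_{u^NG_N},$$ i.e. previous bits are available and future bits are uniformly random. The $i$-th synthesized phase channel $W_{P,B,N}^{(i)}$ uses $G_N^T$ in place of $G_N$, with future bits available and previous bits uniformly random: $$x_i\mapsto\sum_{x_{i+1}^N}\frac1{2^{N-i}}|x_{i+1}^N\rangle\langle x_{i+1}^N|\otimes\sum_{x_1^{i-1}}\frac1{2^{i-1}}\omega_{x^NG_N^T}$$ (up to an input-independent unitary on $C^N$, which does not affect fidelities). Index sets. Let $\mathcal{G}_N(W_{A,B},\beta)=\{i\in[N]:\sqrt{F(W_{A,B,N}^{(i)})}<2^{-N^\beta}\}$,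 $\mathcal{G}_N(W_{P,B},\beta)=\{i\in[N]:\sqrt{F(W_{P,B,N}^{(i)})}<2^{-N^\beta}\}$, and let $\mathcal{B}_N(\cdot,\beta)=[N]\setminus\mathcal{G}_N(\cdot,\beta)$. Define $\mathcal{A}=\mathcal{G}_N(W_{A,B},\beta)\cap\mathcal{G}_N(W_{P,B},\beta)$, $\mathcal{X}=\mathcal{G}_N(W_{A,B},\beta)\cap\mathcal{B}_N(W_{P,B},\beta)$, $\mathcal{Z}=\mathcal{B}_N(W_{A,B},\beta)\cap\mathcal{G}_N(W_{P,B},\beta)$, $\mathcal{B}=\mathcal{B}_N(W_{A,B},\beta)\cap\mathcal{B}_N(W_{P,B},\beta)$. Scheme. The private polar coding scheme sends information bits through the inputs in $\mathcal{A}$, random bits through $\mathcal{X}$, frozen bits (known to sender and receiver) through $\mathcal{Z}$, and secret-key bits shared by sender and receiver through $\mathcal{B}$; the input string $u^N$ is encoded as $u^NG_N$ and each bit $z$ of the result is sent as $\rho_z^{A'}$ over one use of $\mathcal{N}$. The secret key rate is $|\mathcal{B}|/N$. *)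

(* Defs.v *)
From HB Require Import structures.
From mathcomp Require Import all_boot all_order all_algebra.
From mathcomp Require Import spectral mxtens complex.
From mathcomp Require Import all_classical all_reals all_analysis.

Set Implicit Arguments.
Unset Strict Implicit.
Unset Printing Implicit Defensive.

Import Order.TTheory GRing.Theory Num.Theory.
Import numFieldNormedType.Exports.

Local Open Scope ring_scope.
Local Open Scope sesquilinear_scope.

(* A d-dimensional system is C^d with basis 'I_d, an operator on it an element
   of 'M[R[i]]_d, and a ket a column vector; [^t*] is the adjoint and [*t] the
   Kronecker product, whose basis vectors [mxtens_index (i, j)] are |i>|j>.
   Bits have type 'F_2, which is convertible to 'I_2. *)

Section Operators.
Context {R : realType}.

Definition psdmx d (A : 'M[R[i]]_d) : Prop :=
  forall v : 'cV[R[i]]_d, 0 <= (v ^t* *m A *m v) 0 0.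

Definition density d (A : 'M[R[i]]_d) : Prop := psdmx A /\ \tr A = 1.

(* Square root of a positive semidefinite matrix by functional calculus; the
   value on other matrices is irrelevant. *)
Definition sqrtmx d (A : 'M[R[i]]_d) : 'M[R[i]]_d :=
  invmx (spectralmx A) *m diag_mx (map_mx sqrtC (spectral_diag A))
    *m spectralmx A.

(* The trace of |A| is a nonnegative real, so taking [complex.Re] only changes
   its type. *)
Definition trnorm d (A : 'M[R[i]]_d) : R :=
  complex.Re (\tr (sqrtmx (A ^t* *m A))).

Definition cqchannel d := 'F_2 -> 'M[R[i]]_d.

Definition fidelity d (W : cqchannel d) : R :=
  trnorm (sqrtmx (W 0) *m sqrtmx (W 1)) ^+ 2.

Definition ketbra d (v : 'cV[R[i]]_d) : 'M[R[i]]_d := v *m v ^t*.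

Definition ptrace2 d1 d2 (X : 'M[R[i]]_(d1 * d2)) : 'M[R[i]]_d1 :=
  \matrix_(i, j) \sum_(k < d2) X (mxtens_index (i, k)) (mxtens_index (j, k)).

Definition purification d dS (v : 'cV[R[i]]_(d * dS)) (A : 'M[R[i]]_d) : Prop :=
  ptrace2 (ketbra v) = A.

Definition ampliation d d' k (T : 'M[R[i]]_d -> 'M[R[i]]_d')
    (X : 'M[R[i]]_(k * d)) : 'M[R[i]]_(k * d') :=
  \sum_(a < k) \sum_(b < k) delta_mx a b *t
    T (\matrix_(i, j) X (mxtens_index (a, i)) (mxtens_index (b, j))).

Definition completely_positive d d' (T : 'M[R[i]]_d -> 'M[R[i]]_d') : Prop :=
  forall k (X : 'M[R[i]]_(k * d)), psdmx X -> psdmx (ampliation T X).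

Definition trace_preserving d d' (T : 'M[R[i]]_d -> 'M[R[i]]_d') : Prop :=
  forall X, \tr (T X) = \tr X.

Definition isometric_extension d d' dS
    (U : 'M[R[i]]_(d' * dS, d)) (T : 'M[R[i]]_d -> 'M[R[i]]_d') : Prop :=
  U ^t* *m U = 1%:M /\ forall X, T X = ptrace2 (U *m X *m U ^t*).

Definition pauliZ : 'M[R[i]]_2 := diag_mx (\row_(j < 2) (-1) ^+ j).

Definition ket (z : 'F_2) : 'cV[R[i]]_2 := delta_mx z 0.

End Operators.

Section Wiretap.
Context {R : realType}.
Variables dB dE dS1 dS2 : nat.

Definition amplitude_channel (T : 'M[R[i]]_2 -> 'M[R[i]]_(dB * dE))
    (rho : 'F_2 -> 'M[R[i]]_2) : cqchannel dB :=
  fun z => ptrace2 (T (rho z)).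

Definition phi_state (psi : 'F_2 -> 'cV[R[i]]_(2 * dS1)) :
    'cV[R[i]]_(2 * (2 * dS1)) :=
  (sqrtC 2)^-1 *: \sum_(z : 'F_2) ket z *t psi z.

(* Basis vector |c>|b>|e>|s2>|s1> of C (B E S2) S1, where |b>|c>|s1>|s2> is the
   k-th basis vector of B C S1 S2. *)
Definition phase_index (k : 'I_(dB * (2 * (dS1 * dS2)))) (e : 'I_dE) :
    'I_(2 * (dB * dE * dS2 * dS1)) :=
  let: (b, r) := mxtens_unindex k in
  let: (c, s) := mxtens_unindex r in
  let: (s1, s2) := mxtens_unindex s in
  mxtens_index
    (c, mxtens_index (mxtens_index (mxtens_index (b, e), s2), s1)).

Definition ptraceE (X : 'M[R[i]]_(2 * (dB * dE * dS2 * dS1))) :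
    'M[R[i]]_(dB * (2 * (dS1 * dS2))) :=
  \matrix_(i, j) \sum_(e < dE) X (phase_index i e) (phase_index j e).

Definition phase_channel (U : 'M[R[i]]_(dB * dE * dS2, 2))
    (psi : 'F_2 -> 'cV[R[i]]_(2 * dS1)) :
    cqchannel (dB * (2 * (dS1 * dS2))) :=
  fun x => ptraceE
    (ketbra ((1%:M *t (U *t 1%:M)) *m
             ((pauliZ ^+ x *t 1%:M) *m phi_state psi))).

End Wiretap.

Section Encoding.

Fixpoint bitrev (n k : nat) : nat :=
  if n is n'.+1 then (odd k * 2 ^ n' + bitrev n' k./2)%N else 0%N.

Definition bitrev_mx n : 'M['F_2]_(2 ^ n) :=
  \matrix_(i, j) (bitrev n i == j :> nat)%:R.

Definition arikan_kernel : 'M['F_2]_2 := \matrix_(i, j) (j <= i)%N%:R.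

Definition arikan_mx n : 'M['F_2]_(2 ^ n) := bitrev_mx n *m ntensmx arikan_kernel n.

Definition word N (i : 'I_N)
    (p : i.-tuple 'F_2) (b : 'F_2) (f : (N - i.+1).-tuple 'F_2) : 'rV['F_2]_N :=
  \row_(j < N) nth 0 (p ++ b :: f) j.

End Encoding.

Section Synthesis.
Context {R : realType}.

(* N-fold tensor product; the basis of (C^d)^(tensor N) is indexed by the
   finite functions 'I_N -> 'I_d. *)
Definition tensN d N (A : 'I_N -> 'M[R[i]]_d) :
    'M[R[i]]_(#|{: {ffun 'I_N -> 'I_d}}|) :=
  \matrix_(a, b) \prod_(k < N)
    A k ((enum_val a : {ffun 'I_N -> 'I_d}) k)
        ((enum_val b : {ffun 'I_N -> 'I_d}) k).

Definition output_seq d N (W : cqchannel d) (x : 'rV['F_2]_N) :=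
  tensN (fun k => W (x 0 k)).

Definition register k (p : k.-tuple 'F_2) : 'M[R[i]]_(#|{: k.-tuple 'F_2}|) :=
  delta_mx (enum_rank p) (enum_rank p).

(* Indices are 0-based: i : 'I_N has i previous and N - i.+1 future bits. *)
Definition synth_amplitude d n (W : cqchannel d) (i : 'I_(2 ^ n)) :
    cqchannel (#|{: i.-tuple 'F_2}| * #|{: {ffun 'I_(2 ^ n) -> 'I_d}}|) :=
  fun u => \sum_(p : i.-tuple 'F_2) (2 ^+ i)^-1 *: (register p *t
    \sum_(f : (2 ^ n - i.+1).-tuple 'F_2) (2 ^+ (2 ^ n - i.+1))^-1 *:
      output_seq W (word p u f *m arikan_mx n)).

Definition synth_phase d n (W : cqchannel d) (i : 'I_(2 ^ n)) :
    cqchannel (#|{: (2 ^ n - i.+1).-tuple 'F_2}| *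
               #|{: {ffun 'I_(2 ^ n) -> 'I_d}}|) :=
  fun x => \sum_(f : (2 ^ n - i.+1).-tuple 'F_2)
    (2 ^+ (2 ^ n - i.+1))^-1 *: (register f *t
      \sum_(p : i.-tuple 'F_2) (2 ^+ i)^-1 *:
        output_seq W (word p x f *m (arikan_mx n)^T)).

Definition threshold (n : nat) (beta : R) : R :=
  2 `^ (- ((2 ^ n)%:R `^ beta)).

Definition good_amplitude d (W : cqchannel d) (beta : R) n : {set 'I_(2 ^ n)} :=
  [set i | Num.sqrt (fidelity (synth_amplitude W i)) < threshold n beta].

Definition good_phase d (W : cqchannel d) (beta : R) n : {set 'I_(2 ^ n)} :=
  [set i | Num.sqrt (fidelity (synth_phase W i)) < threshold n beta].

Section Scheme.
Variables (dA dP : nat) (WA : @cqchannel R dA) (WP : @cqchannel R dP).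
Variables (beta : R) (n : nat).

Definition information_inputs : {set 'I_(2 ^ n)} :=
  good_amplitude WA beta n :&: good_phase WP beta n.

Definition random_inputs : {set 'I_(2 ^ n)} :=
  good_amplitude WA beta n :&: ~: good_phase WP beta n.

Definition frozen_inputs : {set 'I_(2 ^ n)} :=
  ~: good_amplitude WA beta n :&: good_phase WP beta n.

Definition secret_key_inputs : {set 'I_(2 ^ n)} :=
  ~: good_amplitude WA beta n :&: ~: good_phase WP beta n.

Definition secret_key_rate : R := #|secret_key_inputs|%:R / (2 ^ n)%:R.

End Scheme.
End Synthesis.

(* Main.v *)
(* Measuring each of the N outputs of a channel W in a fixed basis turns the
   synthesized channels of W into those of the classical channel w obtained from
   W by one such measurement, and fidelity only increases.  By Fuchs and Caves a
   basis can be chosen in which the Bhattacharyya parameter of w equals sqrt(F(W)),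
   so upper bounds for w suffice.

   For classical channels, Arikan's step from N to 2N replaces a parameter z by one
   at most 2z - z^2 (even index) and by z^2 (odd index).  Transposing G_N reverses
   the order of the indices, so the amplitude parameter a_i and the phase parameter
   p_i of an index always undergo opposite steps, and a_i + p_i <= 1 is preserved.
   Let q = a_i p_i and L = - ln q.  On average over the two children of i, sqrt q
   shrinks by a factor sqrt 3 / 2, and while L is large, L^(-s) shrinks by about
   (1 + 2^(-s)) / 2.  Hence q |-> L^(-s) + D sqrt q has an average at most
   C lam^n over the indices of block length 2^n, where lam 2^(beta s) < 1 for small s
   because beta < 1/2.  A secret-key index has a_i, p_i >= 2^(-N^beta), thus
   L^(-s) >= c N^(- beta s), and Markov's inequality concludes. *)

Require Import Defs.
From HB Require Import structures.
From mathcomp Require Import all_boot all_order all_algebra.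
From mathcomp Require Import spectral mxtens complex.
From mathcomp Require Import all_classical all_reals all_analysis.
From mathcomp Require Import zify ring lra.
Import Order.TTheory GRing.Theory Num.Theory.
Import numFieldNormedType.Exports.
Local Open Scope sesquilinear_scope.
Local Open Scope ring_scope.
Local Open Scope classical_set_scope.

Set Implicit Arguments.
Unset Strict Implicit.
Unset Printing Implicit Defensive.

(** * Positive semidefinite matrices *)

Section Adjoint.
Context {C : numClosedFieldType}.

Lemma ctrmxM m n p (A : 'M[C]_(m, n)) (B : 'M[C]_(n, p)) :
  (A *m B)^t* = B^t* *m A^t*.
Proof. by rewrite trmx_mul map_mxM. Qed.

Lemma ctrmxB m n (A B : 'M[C]_(m, n)) : (A - B)^t* = A^t* - B^t*.
Proof. by rewrite linearB /= map_mxB. Qed.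

Lemma ctrmx1 n : (1%:M : 'M[C]_n)^t* = 1%:M.
Proof. by rewrite trmx1 map_mx1. Qed.

Lemma ctrmx_diag_ge0 n (d : 'rV[C]_n) :
  (forall k, 0 <= d 0 k) -> (diag_mx d)^t* = diag_mx d.
Proof.
move=> d0; rewrite tr_diag_mx map_diag_mx; congr diag_mx.
by apply/rowP=> k; rewrite !mxE; exact: geC0_conj.
Qed.

Lemma dot_ge0 n (v : 'cV[C]_n) : 0 <= (v^t* *m v) 0 0.
Proof.
by rewrite mxE; apply: sumr_ge0 => k _; rewrite !mxE mulrC mul_conjC_ge0.
Qed.

Lemma cauchy_schwarz n (u v : 'cV[C]_n) :
  `|(u^t* *m v) 0 0| <= sqrtC ((u^t* *m u) 0 0) * sqrtC ((v^t* *m v) 0 0).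
Proof.
have := CauchySchwarz_sqrt (@dotmx C n) (u^t*) (v^t*); rewrite -!/(dotmx _ _).
by case=> h _; move: h; rewrite /= !dotmxE !trmxCK.
Qed.

Lemma mulmx_diag_entry m n p (d : 'rV[C]_n) (A : 'M[C]_(m, n)) (B : 'M[C]_(n, p)) i j :
  (A *m diag_mx d *m B) i j = \sum_k A i k * d 0 k * B k j.
Proof. by rewrite mxE; apply: eq_bigr => k _; rewrite mul_mx_diag mxE. Qed.

End Adjoint.

Section PositiveSemidefinite.
Context {C : numClosedFieldType}.

(* At C = R[i] this is convertible to [psdmx]; rewriting with matrix lemmas is much
   faster over an abstract C. *)
Definition psd d (A : 'M[C]_d) : Prop :=
  forall v : 'cV[C]_d, 0 <= (v^t* *m A *m v) 0 0.

Lemma psd_gram d m (S : 'M[C]_(m, d)) : psd (S^t* *m S).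
Proof. by move=> v; rewrite mulmxA -mulmxA -ctrmxM dot_ge0. Qed.

Lemma psdD d (A B : 'M[C]_d) : psd A -> psd B -> psd (A + B).
Proof. by move=> hA hB v; rewrite mulmxDr mulmxDl mxE addr_ge0. Qed.

Lemma psd_sum d I (r : seq I) (F : I -> 'M[C]_d) :
  (forall k, psd (F k)) -> psd (\sum_(k <- r) F k).
Proof.
move=> hF; elim/big_ind: _ => //; last exact: psdD.
by move=> v; rewrite mulmx0 mul0mx mxE.
Qed.

Lemma psdZ d (c : C) (A : 'M[C]_d) : 0 <= c -> psd A -> psd (c *: A).
Proof. by move=> c0 hA v; rewrite -scalemxAr -scalemxAl mxE mulr_ge0. Qed.

Lemma psd_conj d m (S : 'M[C]_(d, m)) (A : 'M[C]_d) :
  psd A -> psd (S^t* *m A *m S).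
Proof.
by move=> hA v; move: (hA (S *m v)); rewrite ctrmxM !mulmxA.
Qed.

Lemma qform_delta d (A : 'M[C]_d) (i j : 'I_d) (c : C) :
  let v := delta_mx i 0 + c *: delta_mx j 0 : 'cV[C]_d in
  (v^t* *m A *m v) 0 0 = A i i + c * A i j + c^* * A j i + c^* * c * A j j.
Proof.
move=> v.
have adjv : v^t* = delta_mx 0 i + c^* *: delta_mx 0 j.
  apply/matrixP=> a b; rewrite !mxE rmorphD rmorphM /= !rmorph_nat.
  by rewrite !(ord1 a) !eqxx !andbT.
rewrite adjv /v mulmxDl mulmxDr !mulmxDl -!scalemxAl -!scalemxAr -!rowE -!colE.
rewrite !mxE; ring.
Qed.

(** Polarization: the form is real at e_k, e_i + e_j and e_i + 'i e_j, and these three facts give A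
    i j = conj (A j i). *)
Lemma psd_adj d (A : 'M[C]_d) : psd A -> A^t* = A.
Proof.
move=> hA; apply/matrixP=> i j; rewrite !mxE.
have hd k : (A k k)^* = A k k.
  have := hA (delta_mx k 0 + 0 *: delta_mx k 0); rewrite qform_delta.
  rewrite rmorph0 !mul0r !addr0 => /ger0_real /CrealP; exact.
have hc c : (c * A i j + c^* * A j i)^* = c * A i j + c^* * A j i.
  have := hA (delta_mx i 0 + c *: delta_mx j 0); rewrite qform_delta.
  move=> /ger0_real /CrealP; rewrite !rmorphD /= !rmorphM /= !conjCK !hd => h.
  apply: (addrI (A i i)); apply: (addIr (c^* * c * A j j)); rewrite !addrA.
  rewrite -[RHS]h; ring.
have h1 := hc 1; have h2 := hc 'i.
move: h1 h2; rewrite !rmorphD !rmorphM /= !conjCK rmorph1 conjCi !mul1r.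
set a := A i j; set b := A j i => h1 h2.
have i0 : ('i : C) != 0 := neq0Ci _.
have h3 : - a^* + b^* = a - b.
  apply: (mulfI i0); rewrite mulrDr mulrBr !mulrN -!mulNr h2; ring.
apply/eqP; rewrite -subr_eq0; apply/eqP.
have : (b^* - a) *+ 2 = 0.
  have -> : (b^* - a) *+ 2 = (a^* + b^*) + (- a^* + b^*) - (a + a) by ring.
  by rewrite h1 h3; ring.
by move=> /eqP; rewrite mulrn_eq0 => /eqP.
Qed.

Lemma psd_normal d (A : 'M[C]_d) : psd A -> A \is normalmx.
Proof. by move=> /psd_adj hA; apply/normalmxP; rewrite hA. Qed.

Lemma spectral_diag_ge0 d (A : 'M[C]_d) k : psd A -> 0 <= spectral_diag A 0 k.
Proof.
move=> hA; set Q := spectralmx A.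
have Qu : Q \is unitarymx := spectral_unitarymx A.
have /orthomx_spectralP := psd_normal hA; rewrite -/Q => eA.
have := hA (Q^t* *m delta_mx k 0); rewrite ctrmxM trmxCK {1}eA invmx_unitary //.
rewrite !mulmxA; have QQ : Q *m Q^t* = 1%:M by apply/unitarymxP.
rewrite -[_ *m Q *m _]mulmxA QQ mulmx1 -[X in X *m diag_mx _]mulmxA QQ mulmx1.
rewrite mulmx_diag_entry (bigD1 k) //= big1 ?addr0; last first.
  by move=> j jk; rewrite !mxE (negbTE jk) mulr0.
by rewrite !mxE !eqxx /= rmorph1 mul1r mulr1.
Qed.

End PositiveSemidefinite.

(* Locked: otherwise rewriting with [mulmxA] unfolds it to a product. *)
HB.lock
Definition funmx (C : numClosedFieldType) d (A : 'M[C]_d) (f : C -> C) : 'M[C]_d :=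
  (spectralmx A)^t* *m diag_mx (map_mx f (spectral_diag A)) *m spectralmx A.

(** * Functional calculus, polar decomposition and the Fuchs-Caves measurement *)

Section FunctionalCalculus.
Context {C : numClosedFieldType}.

Lemma spectralmxK d (A : 'M[C]_d) : spectralmx A *m (spectralmx A)^t* = 1%:M.
Proof. exact/unitarymxP/spectral_unitarymx. Qed.

Lemma spectralmxKV d (A : 'M[C]_d) : (spectralmx A)^t* *m spectralmx A = 1%:M.
Proof. exact/mulmx1C/spectralmxK. Qed.

Lemma eq_funmx d (A : 'M[C]_d) f g :
  (forall k, f (spectral_diag A 0 k) = g (spectral_diag A 0 k)) ->
  funmx A f = funmx A g.
Proof.
move=> h; rewrite !funmx.unlock; congr (_ *m diag_mx _ *m _).
by apply/rowP=> k; rewrite !mxE.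
Qed.

Lemma funmxM d (A : 'M[C]_d) f g :
  funmx A f *m funmx A g = funmx A (fun x => f x * g x).
Proof.
rewrite !funmx.unlock !mulmxA -[_ *m spectralmx A *m _]mulmxA spectralmxK mulmx1.
rewrite -[_ *m diag_mx _ *m diag_mx _]mulmxA mulmx_diag.
by congr (_ *m diag_mx _ *m _); apply/rowP=> k; rewrite !mxE.
Qed.

Lemma funmx_id d (A : 'M[C]_d) : psd A -> funmx A id = A.
Proof.
move=> /psd_normal/orthomx_spectralP {2}->.
rewrite invmx_unitary ?spectral_unitarymx // !funmx.unlock.
by congr (_ *m diag_mx _ *m _); apply/rowP=> k; rewrite !mxE.
Qed.

Definition sqrtm d (A : 'M[C]_d) := funmx A sqrtC.

Lemma psd_diag d (e : 'rV[C]_d) : (forall k, 0 <= e 0 k) -> psd (diag_mx e).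
Proof.
move=> e0; have -> : diag_mx e = (diag_mx (map_mx sqrtC e))^t* *m
                                 diag_mx (map_mx sqrtC e).
  rewrite ctrmx_diag_ge0 => [|k]; last by rewrite mxE sqrtC_ge0.
  rewrite mulmx_diag; congr diag_mx; apply/rowP=> k.
  by rewrite !mxE -expr2 sqrtCK.
exact: psd_gram.
Qed.

Lemma psd_funmx d (A : 'M[C]_d) f :
  (forall k, 0 <= f (spectral_diag A 0 k)) -> psd (funmx A f).
Proof. by move=> h; rewrite funmx.unlock; apply/psd_conj/psd_diag => k; rewrite mxE. Qed.

Lemma psd_sqrtm d (A : 'M[C]_d) : psd A -> psd (sqrtm A).
Proof.
move=> hA; apply: psd_funmx => k.
by rewrite sqrtC_ge0 spectral_diag_ge0.
Qed.

Lemma sqrtmK d (A : 'M[C]_d) : psd A -> sqrtm A *m sqrtm A = A.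
Proof.
move=> hA; rewrite -[RHS]funmx_id // funmxM; apply: eq_funmx => k.
by rewrite -expr2 sqrtCK.
Qed.

(** W is |M|^(-1) times the adjoint of M, the inverse being taken on the support only. It is a
    partial isometry, hence a contraction, as the later Cauchy-Schwarz estimate requires. *)
Lemma polar_contraction d (M : 'M[C]_d) : exists W : 'M[C]_d,
  W *m M = sqrtm (M^t* *m M) /\
  forall x : 'cV[C]_d, ((W *m x)^t* *m (W *m x)) 0 0 <= (x^t* *m x) 0 0.
Proof.
set B := M^t* *m M; have Bp : psd B := psd_gram M.
(* Since 0^-1 = 0, this gives the pseudo-inverse of the square root: it vanishes on the kernel of
   B. *)
pose f := fun x : C => (sqrtC x)^-1.
have f0 k : 0 <= f (spectral_diag B 0 k).
  by rewrite invr_ge0 sqrtC_ge0 spectral_diag_ge0.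
have fadj : (funmx B f)^t* = funmx B f by apply/psd_adj/psd_funmx.
exists (funmx B f *m M^t*); split.
  rewrite -mulmxA -/B -[X in _ *m X]funmx_id // funmxM; apply: eq_funmx => k.
  set x := spectral_diag B 0 k; rewrite /f.
  have [->|x0] := eqVneq x 0; first by rewrite sqrtC0 mulr0.
  by rewrite -{2}[x]sqrtCK expr2 mulrA mulVf ?mul1r // sqrtC_eq0.
set W := funmx B f *m M^t*; set P := W^t* *m W.
have adjP : P^t* = P by rewrite /P ctrmxM trmxCK.
(* W is a partial isometry, so P is a projection and |x|^2 - |W x|^2 = |(1 - P) x|^2 >= 0. *)
have PP : P *m P = P.
  have -> : P *m P = W^t* *m (W *m W^t* *m W) by rewrite /P !mulmxA.
  congr (W^t* *m _).
  have -> : W *m W^t* = funmx B f *m B *m funmx B f.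
    by rewrite /W ctrmxM trmxCK fadj !mulmxA.
  rewrite -[X in _ *m X *m _ *m _]funmx_id // !funmxM.
  rewrite /W mulmxA funmxM; congr (_ *m _); apply: eq_funmx => k.
  set x := spectral_diag B 0 k; rewrite /f.
  have [->|x0] := eqVneq x 0; first by rewrite sqrtC0 invr0 !mul0r.
  by rewrite -{2}[x]sqrtCK; field; rewrite sqrtC_eq0.
move=> x; have -> : (W *m x)^t* *m (W *m x) = x^t* *m P *m x.
  by rewrite ctrmxM !mulmxA.
have := dot_ge0 ((1%:M - P) *m x); rewrite ctrmxM ctrmxB ctrmx1 adjP.
rewrite mulmxA -[x^t* *m _ *m _]mulmxA mulmxBl mul1mx.
rewrite [P *m (_ - _)]mulmxBr mulmx1 PP subrr subr0 mulmxBr mulmx1 mulmxBl.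
by rewrite !mxE subr_ge0.
Qed.

(** A rank-one measurement: outcome k has weight <b k| A |b k>, and completeness makes the weights
    add up to the trace. [K] is a general finite type because product measurements have functions
    and tuples as outcomes. *)
Definition is_measurement d (K : finType) (b : K -> 'cV[C]_d) : Prop :=
  \sum_k b k *m (b k)^t* = 1%:M.

Lemma mxtrace_measurement d (K : finType) (b : K -> 'cV[C]_d) (X : 'M[C]_d) :
  is_measurement b -> \tr X = \sum_k ((b k)^t* *m X *m b k) 0 0.
Proof.
move=> hb; rewrite -[X in LHS]mulmx1 -hb mulmx_sumr linear_sum /=.
by apply: eq_bigr => k _; rewrite mulmxA mxtrace_mulC mulmxA trace_mx11.
Qed.

(** With |M| = W M, the trace is that of sqrt s W sqrt r. Expand it over the measurement and apply
    Cauchy-Schwarz to sqrt s b_k and W sqrt r b_k. *)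
Lemma tr_sqrtm_le_measurement d (K : finType) (b : K -> 'cV[C]_d) (r s : 'M[C]_d)
    (M := sqrtm r *m sqrtm s) :
  is_measurement b -> psd r -> psd s ->
  \tr (sqrtm (M^t* *m M)) <=
  \sum_k sqrtC (((b k)^t* *m r *m b k) 0 0) * sqrtC (((b k)^t* *m s *m b k) 0 0).
Proof.
move=> hb hr hs.
have tr0 : 0 <= \tr (sqrtm (M^t* *m M)).
  rewrite (mxtrace_measurement _ hb); apply: sumr_ge0 => k _.
  by apply: psd_sqrtm; apply: psd_gram.
have [W [WM Wle]] := polar_contraction M.
rewrite -(ger0_norm tr0) -WM /M mulmxA mxtrace_mulC mulmxA.
rewrite (mxtrace_measurement _ hb); apply: le_trans (ler_norm_sum _ _ _) _.
apply: ler_sum => k _.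
have adjr := psd_adj (psd_sqrtm hr); have adjs := psd_adj (psd_sqrtm hs).
have -> : (b k)^t* *m (sqrtm s *m W *m sqrtm r) *m b k =
    (sqrtm s *m b k)^t* *m (W *m (sqrtm r *m b k)).
  by rewrite ctrmxM adjs !mulmxA.
apply: le_trans (cauchy_schwarz _ _) _; rewrite mulrC.
apply: ler_pM; rewrite ?sqrtC_ge0 ?dot_ge0 //.
  rewrite ler_sqrtC ?nnegrE ?dot_ge0 ?hr //.
  apply: le_trans (Wle _) _.
  by rewrite ctrmxM adjr mulmxA -[_ *m sqrtm r *m sqrtm r]mulmxA sqrtmK.
by rewrite ctrmxM adjs mulmxA -[_ *m sqrtm s *m sqrtm s]mulmxA sqrtmK.
Qed.

Lemma dot_eq0 d (v : 'cV[C]_d) : (v^t* *m v) 0 0 = 0 -> v = 0.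
Proof.
rewrite mxE => /eqP; rewrite psumr_eq0 => [/allP h|k _]; last first.
  by rewrite !mxE mulrC mul_conjC_ge0.
apply/colP=> k; have := h k (mem_index_enum k).
by rewrite !mxE mulrC mul_conjC_eq0 => /eqP.
Qed.

Lemma mul_spectral_col d (Y : 'M[C]_d) k : Y^t* = Y ->
  Y *m col k ((spectralmx Y)^t*) = spectral_diag Y 0 k *: col k ((spectralmx Y)^t*).
Proof.
move=> Yadj; have /orthomx_spectralP eY : Y \is normalmx.
  by apply/normalmxP; rewrite Yadj.
rewrite {1}eY invmx_unitary ?spectral_unitarymx // !colE !mulmxA.
rewrite -[_ *m spectralmx Y *m _]mulmxA spectralmxK mulmx1.
rewrite -[_ *m diag_mx _ *m _]mulmxA scalemxAr; congr (_ *m _).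
apply/colP=> j; rewrite mul_diag_mx !mxE; case: eqVneq => [->|_] //.
by rewrite !mulr0.
Qed.

Lemma spectral_measurement d (Y : 'M[C]_d) :
  is_measurement (fun k => col k ((spectralmx Y)^t*)).
Proof.
rewrite /is_measurement -(spectralmxKV Y); apply/matrixP=> i j.
rewrite summxE [RHS]mxE; apply: eq_bigr => k _.
by rewrite !mxE big_ord1 !mxE conjCK.
Qed.

(* With X = s^(-1/2) |M| s^(-1/2) and P the support projection of s, one has
   X s X = P r P.  An eigenvector of X - (1 - P) lies in the support of s, where it is
   an eigenvector of X, if its eigenvalue is nonnegative, and in the kernel of s
   otherwise. *)
Lemma fuchs_caves d (r s : 'M[C]_d) (M := sqrtm r *m sqrtm s) :
  psd r -> psd s ->
  exists b : 'I_d -> 'cV[C]_d, is_measurement b /\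
  \sum_k sqrtC (((b k)^t* *m r *m b k) 0 0 * ((b k)^t* *m s *m b k) 0 0) =
  \tr (sqrtm (M^t* *m M)).
Proof.
move=> hr hs; set B := sqrtm (M^t* *m M).
have hB : psd B by apply/psd_sqrtm/psd_gram.
have adjr := psd_adj (psd_sqrtm hr); have adjs := psd_adj (psd_sqrtm hs).
have adjB := psd_adj hB.
(* [T] inverts sqrt s on its support and is 0 on the kernel, because 0^-1 = 0; [P] is the support
   projection. *)
pose S := sqrtm s; pose T := funmx s (fun x => (sqrtC x)^-1).
pose P := funmx s (fun x => (x != 0)%:R).
have d0 k : 0 <= spectral_diag s 0 k by apply: spectral_diag_ge0.
have adjT : T^t* = T by apply/psd_adj/psd_funmx => k; rewrite invr_ge0 sqrtC_ge0.
have adjP : P^t* = P by apply/psd_adj/psd_funmx => k; rewrite ler0n.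
have simp f g h : (forall x, f x * g x = h x) -> funmx s f *m funmx s g = funmx s h.
  by move=> e; rewrite funmxM; apply: eq_funmx => k.
have PT : P *m T = T.
  apply: simp => x; case: eqVneq => [->|_]; first by rewrite sqrtC0 invr0 mulr0.
  by rewrite mul1r.
have PP : P *m P = P by apply: simp => x; case: eqVneq; rewrite ?mulr0 ?mulr1.
have TS : T *m S = P.
  apply: simp => x; case: eqVneq => [->|x0]; first by rewrite sqrtC0 mulr0.
  by rewrite mulVf // sqrtC_eq0.
have PS : P *m S = S.
  apply: simp => x; case: eqVneq => [->|_]; first by rewrite sqrtC0 mulr0.
  by rewrite mul1r.
have TP : T *m P = T by rewrite -[LHS]trmxCK ctrmxM adjT adjP PT adjT.
have ST : S *m T = P by rewrite -[LHS]trmxCK ctrmxM adjT adjs TS adjP.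
have SP : S *m P = S by rewrite -[LHS]trmxCK ctrmxM adjs adjP PS adjs.
have sE : s = S *m S by rewrite sqrtmK.
have BP : B *m P = B.
  have [W [WM _]] := polar_contraction M.
  by rewrite /B -WM /M -/S -!mulmxA SP.
have BB : B *m B = S *m r *m S.
  rewrite /B sqrtmK; last exact: psd_gram.
  by rewrite /M ctrmxM adjr adjs -/S !mulmxA -[_ *m sqrtm r *m sqrtm r]mulmxA sqrtmK.
pose X := T *m B *m T.
have hX : psd X by rewrite /X -{1}adjT; apply: psd_conj.
have adjX := psd_adj hX.
have XsX : X *m s *m X = P *m r *m P.
  rewrite /X sE !mulmxA -[_ *m T *m S]mulmxA TS -[_ *m P *m S]mulmxA PS.
  rewrite -[_ *m S *m T]mulmxA ST -[_ *m B *m P]mulmxA BP -[T *m B *m B]mulmxA BB.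
  by rewrite !mulmxA TS -[_ *m S *m T]mulmxA ST.
have PX : P *m X = X by rewrite /X !mulmxA PT.
have XP : X *m P = X by rewrite /X -mulmxA TP.
pose Y := X - (1%:M - P).
have adjY : Y^t* = Y by rewrite /Y !ctrmxB adjX adjP ctrmx1.
have trXs : \tr (X *m s) = \tr B.
  rewrite /X sE !mulmxA -[_ *m T *m S]mulmxA TS mxtrace_mulC !mulmxA ST.
  by rewrite -mulmxA BP mxtrace_mulC BP.
exists (fun k => col k ((spectralmx Y)^t*)); split; first exact: spectral_measurement.
rewrite -trXs (mxtrace_measurement _ (spectral_measurement Y)).
apply: eq_bigr => k _; set q := col k _; set y := spectral_diag Y 0 k.
have Yq : Y *m q = y *: q by apply: mul_spectral_col.
have yR : y \is Num.real.
  have Yh : Y \is hermsymmx by apply/is_hermitianmxP; rewrite expr0 scale1r.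
  by have /mxOverP := hermitian_spectral_diag_real Yh; apply.
have PYq : X *m q = y *: (P *m q).
  by rewrite scalemxAr -Yq mulmxA /Y mulmxBr mulmxBr PX mulmx1 PP subrr subr0.
have adjXq : q^t* *m X = (X *m q)^t* by rewrite ctrmxM adjX.
have [y0|y0] := real_ge0P yR.
  (* X q = y P q turns Y q = y q into (1 + y)(q - P q) = 0, and 1 + y > 0 here. *)
  have Pq : P *m q = q.
    have : (1 + y) *: (q - P *m q) = 0.
      have := Yq; rewrite /Y !mulmxBl mul1mx PYq => h.
      by rewrite scalerDl scale1r scalerBr -h addrC addrAC subrK subrr.
    move/eqP; rewrite scaler_eq0 subr_eq0 paddr_eq0 // oner_eq0 /=.
    by move=> /eqP /esym.
  have Xq : X *m q = y *: q by rewrite PYq Pq.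
  have adjqX : q^t* *m X = y *: q^t*.
    by rewrite adjXq Xq linearZ /= map_mxZ; congr (_ *: _); exact: conj_Creal.
  (* So <q|r|q> = y^2 <q|s|q>, and the square root and the trace term are both y <q|s|q>. *)
  have -> : q^t* *m r *m q = q^t* *m X *m s *m (X *m q).
    have -> : q^t* *m X *m s *m (X *m q) = q^t* *m (X *m s *m X) *m q.
      by rewrite !mulmxA.
    by rewrite XsX -[in LHS]Pq ctrmxM adjP !mulmxA.
  have scE a (A : 'M[C]_1) : (a *: A) 0 0 = a * A 0 0 by rewrite mxE.
  rewrite [q^t* *m (X *m s)]mulmxA adjqX Xq -!scalemxAl -!scalemxAr !scE.
  set z := (_ *m _) 0 0; have z0 : 0 <= z by apply: hs.
  have -> : y * (y * z) * z = (y * z) ^+ 2 by rewrite expr2; ring.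
  by rewrite sqrCK // mulr_ge0.
(* Positivity of X at P q reads 0 <= y |P q|^2, while y < 0. *)
have Pq : P *m q = 0.
  apply: dot_eq0; apply/eqP; rewrite eq_le dot_ge0 andbT.
  have := hX (P *m q); rewrite -mulmxA [X *m _]mulmxA XP PYq -scalemxAr mxE.
  by rewrite nmulr_rge0.
have Sq : S *m q = 0 by rewrite -SP -mulmxA Pq mulmx0.
have sq : s *m q = 0 by rewrite sE -mulmxA Sq mulmx0.
have -> : q^t* *m s *m q = 0 by rewrite -mulmxA sq mulmx0.
have -> : q^t* *m (X *m s) *m q = 0 by rewrite -!mulmxA sq !mulmx0.
have z00 : (0 : 'M[C]_1) 0 0 = 0 by rewrite mxE.
by rewrite z00 mulr0 sqrtC0.
Qed.

End FunctionalCalculus.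

(** * Fidelity and measurements *)

Section Measurement.
Context {R : realType}.
Local Notation C := R[i].
Local Notation real_complex := (real_complex R).

Definition expect d (A : 'M[C]_d) (v : 'cV[C]_d) : R :=
  complex.Re ((v^t* *m A *m v) 0 0).

Lemma sqrtmxE d (A : 'M[C]_d) : sqrtmx A = sqrtm A.
Proof.
by rewrite /sqrtmx invmx_unitary ?spectral_unitarymx // /sqrtm funmx.unlock.
Qed.

Lemma Re_ge0 (x : C) : 0 <= x -> 0 <= complex.Re x.
Proof. by rewrite lecE => /andP[]. Qed.

Lemma sqrtC_complex (x : C) :
  0 <= x -> sqrtC x = real_complex (Num.sqrt (complex.Re x)).
Proof.
move=> x0; set y := Num.sqrt _; have <- : real_complex y ^+ 2 = x.
  by rewrite -rmorphXn /= sqr_sqrtr ?Re_ge0 // RRe_real ?ger0_real.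
by rewrite sqrCK // ler0c sqrtr_ge0.
Qed.

Lemma expect_ge0 d (A : 'M[C]_d) v : psdmx A -> 0 <= expect A v.
Proof. by move=> hA; apply/Re_ge0/hA. Qed.

Lemma trnorm_sqrtmx d (r s : 'M[C]_d) (M := sqrtm r *m sqrtm s) :
  trnorm (sqrtmx r *m sqrtmx s) = complex.Re (\tr (sqrtm (M^t* *m M))).
Proof. by rewrite /trnorm !sqrtmxE. Qed.

Lemma trnorm_le_measure d (K : finType) (b : K -> 'cV[C]_d) (r s : 'M[C]_d) :
  is_measurement b -> psdmx r -> psdmx s ->
  trnorm (sqrtmx r *m sqrtmx s) <=
  \sum_k Num.sqrt (expect r (b k)) * Num.sqrt (expect s (b k)).
Proof.
move=> hb hr hs; rewrite trnorm_sqrtmx.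
have := tr_sqrtm_le_measurement hb hr hs; rewrite lecE => /andP[_ h].
apply: le_trans h _; rewrite raddf_sum /=; apply: ler_sum => k _.
by rewrite !sqrtC_complex ?hr ?hs // -rmorphM.
Qed.

Lemma trnorm_attained d (r s : 'M[C]_d) : psdmx r -> psdmx s ->
  exists2 b : 'I_d -> 'cV[C]_d, is_measurement b &
  \sum_k Num.sqrt (expect r (b k)) * Num.sqrt (expect s (b k)) =
  trnorm (sqrtmx r *m sqrtmx s).
Proof.
move=> hr hs; have [b [hb e]] := fuchs_caves hr hs; exists b => //.
rewrite trnorm_sqrtmx -e raddf_sum /=; apply: eq_bigr => k _.
by rewrite sqrtCM ?nnegrE ?hr ?hs // !sqrtC_complex ?hr ?hs // -rmorphM.
Qed.

Lemma trnorm_ge0 d (M : 'M[C]_d) : 0 <= trnorm M.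
Proof.
rewrite /trnorm sqrtmxE; apply: Re_ge0.
rewrite (mxtrace_measurement _ (spectral_measurement M)); apply: sumr_ge0 => k _.
exact/psd_sqrtm/psd_gram.
Qed.

Lemma sqrt_fidelity d (W : @cqchannel R d) :
  Num.sqrt (fidelity W) = trnorm (sqrtmx (W 0) *m sqrtmx (W 1)).
Proof. by rewrite /fidelity sqrtr_sqr ger0_norm ?trnorm_ge0. Qed.

Lemma sum_expect d (K : finType) (b : K -> 'cV[C]_d) (A : 'M[C]_d) :
  is_measurement b -> \sum_k expect A (b k) = complex.Re (\tr A).
Proof. by move=> hb; rewrite (mxtrace_measurement _ hb) raddf_sum. Qed.

Lemma expect_sum d I (r : seq I) (F : I -> 'M[C]_d) v :
  expect (\sum_(k <- r) F k) v = \sum_(k <- r) expect (F k) v.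
Proof.
by rewrite /expect mulmx_sumr mulmx_suml summxE raddf_sum.
Qed.

Lemma expectZ d (c : R) (A : 'M[C]_d) v :
  expect (real_complex c *: A) v = c * expect A v.
Proof.
by rewrite /expect -scalemxAr -scalemxAl mxE; case: (_ 0 0) => a b /=; simpc.
Qed.

End Measurement.

(** * Arikan's matrix *)

Section ArikanEntries.

(* Bit reversal pairs the least significant bit of the row with the most significant
   bit of the column. *)
Fixpoint arikan_entry n (i j : nat) : 'F_2 :=
  if n is n'.+1 then
    (j %/ 2 ^ n' <= odd i)%N%:R * arikan_entry n' i./2 (j %% 2 ^ n')
  else 1.

Fixpoint kernel_pow_entry n (i j : nat) : 'F_2 :=
  if n is n'.+1 then
    (j %/ 2 ^ n' <= i %/ 2 ^ n')%N%:R *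
      kernel_pow_entry n' (i %% 2 ^ n') (j %% 2 ^ n')
  else 1.

Lemma ntensmx_kernelE n (i j : 'I_(2 ^ n)) :
  ntensmx arikan_kernel n i j = kernel_pow_entry n i j.
Proof.
case: n i j => [|n] i j; first by rewrite ntensmx0 !ord1 mxE.
elim: n i j => [|n IH] i j.
  by rewrite ntensmx1 mxE /= expn0 !divn1 mulr1.
rewrite ntensmxSS mxE IH mxE.
by [].
Qed.

Lemma bitrev_lt n k : (bitrev n k < 2 ^ n)%N.
Proof.
elim: n k => [|n IH] k //=; rewrite expnS; have := IH k./2.
by case: (odd k) => /=; lia.
Qed.

Lemma kernel_pow_bitrev n i j :
  kernel_pow_entry n (bitrev n i) j = arikan_entry n i j.
Proof.
elim: n i j => [|n IH] i j //=.
have h := bitrev_lt n i./2.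
by rewrite divnMDl ?expn_gt0 // modnMDl (divn_small h) (modn_small h) addn0 IH.
Qed.

Lemma arikan_mxE n (i j : 'I_(2 ^ n)) : arikan_mx n i j = arikan_entry n i j.
Proof.
rewrite mxE (bigD1 (Ordinal (bitrev_lt n i))) //= big1 ?addr0 => [|k kb].
  by rewrite mxE eqxx mul1r ntensmx_kernelE kernel_pow_bitrev.
by rewrite mxE eq_sym (negbTE (_ : val k != bitrev n i)) ?mul0r.
Qed.

Definition bit t k := odd (k %/ 2 ^ t).

Lemma bit_mod n t j : (t < n)%N -> bit t (j %% 2 ^ n) = bit t j.
Proof.
move=> tn; rewrite /bit [in RHS](divn_eq j (2 ^ n)).
have -> : (j %/ 2 ^ n * 2 ^ n = (j %/ 2 ^ n * 2 ^ (n - t.+1) * 2) * 2 ^ t)%N.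
  by rewrite -!mulnA -expnS -expnD; congr (_ * 2 ^ _)%N; lia.
by rewrite divnMDl ?expn_gt0 // oddD oddM andbF.
Qed.

(** An entry of K is 1 exactly when the column bit implies the row bit, and bit reversal pairs bit t
    of the column with bit n - 1 - t of the row. Implications make the effect of complementing all
    bits visible. *)
Lemma arikan_entry_bits n i j : (j < 2 ^ n)%N ->
  arikan_entry n i j = \prod_(t < n) (bit t j ==> bit (n - t.+1) i)%:R.
Proof.
elim: n i j => [|n IH] i j jn; first by rewrite big_ord0.
rewrite big_ord_recr /= mulrC; congr (_ * _).
  rewrite IH ?ltn_pmod ?expn_gt0 //; apply: eq_bigr => t _.
  have tn := ltn_ord t.
  congr ((_ ==> _)%:R).
    exact: bit_mod.
  rewrite /bit -divn2 -divnMA -expnS; congr (odd (_ %/ 2 ^ _)); lia.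
rewrite /bit subnn expn0 divn1.
have : (j %/ 2 ^ n < 2)%N by rewrite ltn_divLR ?expn_gt0 // -expnS.
by case: (j %/ _)%N => [|[|]] //; case: (odd i).
Qed.

Lemma bit_rev n t k : (t < n)%N -> (k < 2 ^ n)%N ->
  bit t (2 ^ n - k.+1) = ~~ bit t k.
Proof.
rewrite /bit => tn kn.
have := divn_eq k (2 ^ t); have := ltn_pmod k (expn_gt0 2 t).
set q := (k %/ _)%N; set r := (k %% _)%N => rt ek.
have e : (2 ^ n = 2 ^ (n - t.+1) * 2 * 2 ^ t)%N.
  by rewrite -expnSr -expnD; congr expn; lia.
(* Quotient and remainder by 2^t are mirrored separately; the number of quotients is even, so
   mirroring flips the parity of the quotient. *)
have -> : (2 ^ n - k.+1 = (2 ^ (n - t.+1) * 2 - q.+1) * 2 ^ t + (2 ^ t - r.+1))%N.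
  have : (q < 2 ^ (n - t.+1) * 2)%N by rewrite ltn_divLR ?expn_gt0 // -e.
  rewrite e ek; nia.
rewrite divnMDl ?expn_gt0 // divn_small ?addn0; last by lia.
rewrite oddB; last by rewrite ltn_divLR ?expn_gt0 // -e.
by rewrite oddM andbF.
Qed.

(** Reversing an index complements its bits, and each implication becomes its contrapositive.
    Transposing the matrix is thus reversing the order of both inputs and outputs. *)
Lemma arikan_mx_rev n (i j : 'I_(2 ^ n)) :
  arikan_mx n j i = arikan_mx n (rev_ord i) (rev_ord j).
Proof.
rewrite !arikan_mxE !arikan_entry_bits //.
rewrite (reindex_inj rev_ord_inj) /=; apply: eq_bigr => t _.
have tn := ltn_ord t.
rewrite !bit_rev //; last by lia.
by rewrite implybNN; congr ((bit _ _ ==> bit _ _)%:R); lia.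
Qed.

End ArikanEntries.

(** * Passing from block length N to 2N *)

Section Halving.
Variable n : nat.
Local Notation N := (2 ^ n)%N.
Local Notation N2 := (2 ^ n.+1)%N.

Lemma even_pos_lt (j : 'I_N) : (j.*2 < N2)%N.
Proof. by rewrite expnS mul2n ltn_double. Qed.

Lemma odd_pos_lt (j : 'I_N) : (j.*2.+1 < N2)%N.
Proof. by rewrite expnS mul2n ltn_Sdouble. Qed.

Lemma low_pos_lt (j : 'I_N) : (j < N2)%N.
Proof. by have := ltn_ord j; rewrite expnS; lia. Qed.

Lemma high_pos_lt (j : 'I_N) : (N + j < N2)%N.
Proof. by have := ltn_ord j; rewrite expnS; lia. Qed.

Lemma half_pos_lt (k : 'I_N2) : (k./2 < N)%N.
Proof. by case: k => k /=; rewrite expnS; lia. Qed.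

Lemma mod_pos_lt (k : 'I_N2) : (k %% N < N)%N.
Proof. by rewrite ltn_mod expn_gt0. Qed.

(** Inputs are paired as 2j and 2j + 1, while channel uses are split into the first N and the last
    N: bit reversal matches the lowest bit of one with the highest bit of the other. *)
Definition even_pos j := Ordinal (even_pos_lt j).
Definition odd_pos j := Ordinal (odd_pos_lt j).
Definition low_pos j := Ordinal (low_pos_lt j).
Definition high_pos j := Ordinal (high_pos_lt j).
Definition half_pos k := Ordinal (half_pos_lt k).
Definition mod_pos k := Ordinal (mod_pos_lt k).

Lemma half_posP (k : 'I_N2) :
  k = if odd k then odd_pos (half_pos k) else even_pos (half_pos k).
Proof. by apply: val_inj; rewrite -[LHS]odd_double_half; case: (odd k). Qed.

Lemma mod_posP (k : 'I_N2) :
  k = if (k < N)%N then low_pos (mod_pos k) else high_pos (mod_pos k).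
Proof.
apply: val_inj; case: k => k /= k2; case: ltnP => kN /=; first by rewrite modn_small.
rewrite -[in RHS](subnKC kN) modnDl modn_small ?subnKC //.
by move: k2; rewrite expnS; lia.
Qed.

Lemma half_even_pos j : half_pos (even_pos j) = j.
Proof. by apply: val_inj => /=; rewrite doubleK. Qed.

Lemma half_odd_pos j : half_pos (odd_pos j) = j.
Proof. by apply: val_inj => /=; rewrite uphalf_double. Qed.

Lemma mod_low_pos j : mod_pos (low_pos j) = j.
Proof. by apply: val_inj => /=; rewrite modn_small. Qed.

Lemma mod_high_pos j : mod_pos (high_pos j) = j.
Proof. by apply: val_inj => /=; rewrite modnDl modn_small. Qed.

Lemma big_even_odd (T : Type) (idx : T) (op : Monoid.com_law idx)
    (F : 'I_N2 -> T) :
  \big[op/idx]_k F k = \big[op/idx]_(j < N) op (F (even_pos j)) (F (odd_pos j)).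
Proof.
rewrite (reindex (fun x : 'I_N * bool =>
  if x.2 then odd_pos x.1 else even_pos x.1)) /=.
  rewrite -(pair_bigA _
    (fun j (b : bool) => F (if b then odd_pos j else even_pos j))) /=.
  by apply: eq_bigr => j _; rewrite big_bool Monoid.mulmC.
exists (fun k => (half_pos k, odd k)) => [[j b] _|k _] /=; last by rewrite -half_posP.
by case: b; rewrite ?half_odd_pos ?half_even_pos /= odd_double.
Qed.

Lemma big_low_high (T : Type) (idx : T) (op : Monoid.com_law idx)
    (F : 'I_N2 -> T) :
  \big[op/idx]_k F k =
  op (\big[op/idx]_(j < N) F (low_pos j)) (\big[op/idx]_(j < N) F (high_pos j)).
Proof.
rewrite -big_split (reindex (fun x : 'I_N * bool =>
  if x.2 then high_pos x.1 else low_pos x.1)) /=.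
  rewrite -(pair_bigA _
    (fun j (b : bool) => F (if b then high_pos j else low_pos j))) /=.
  by apply: eq_bigr => j _; rewrite big_bool Monoid.mulmC.
exists (fun k => (mod_pos k, (N <= k)%N)) => [[j b] _|k _] /=.
  by case: b; rewrite ?mod_low_pos ?mod_high_pos ?leq_addr //= leqNgt ltn_ord.
by rewrite [RHS]mod_posP ltnNge; case: (N <= k)%N.
Qed.

Implicit Types (v : 'rV['F_2]_N2) (a b : 'rV['F_2]_N).

(** The words that Arikan's butterfly feeds to the two copies: encoding v is encoding the minus part
    on the first N uses and the plus part on the last N. *)
Definition minus_part v : 'rV['F_2]_N :=
  \row_j (v 0 (even_pos j) + v 0 (odd_pos j)).
Definition plus_part v : 'rV['F_2]_N := \row_j v 0 (odd_pos j).
Definition interleave a b : 'rV['F_2]_N2 :=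
  \row_k (if odd k then b 0 (half_pos k) else a 0 (half_pos k) + b 0 (half_pos k)).

Lemma addF2K (x y : 'F_2) : x + y + y = x.
Proof.
rewrite -addrA -mulr2n -mulr_natr (_ : 2%:R = 0) ?mulr0 ?addr0 //.
exact/val_inj.
Qed.

Lemma interleave_even a b j : interleave a b 0 (even_pos j) = a 0 j + b 0 j.
Proof. by rewrite mxE /= odd_double half_even_pos. Qed.

Lemma interleave_odd a b j : interleave a b 0 (odd_pos j) = b 0 j.
Proof. by rewrite mxE /= odd_double half_odd_pos. Qed.

Lemma minus_part_interleave a b : minus_part (interleave a b) = a.
Proof. by apply/rowP=> j; rewrite mxE interleave_even interleave_odd addF2K. Qed.

Lemma plus_part_interleave a b : plus_part (interleave a b) = b.
Proof. by apply/rowP=> j; rewrite mxE interleave_odd. Qed.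

Lemma interleave_parts v : interleave (minus_part v) (plus_part v) = v.
Proof.
apply/rowP=> k; rewrite [in RHS](half_posP k) mxE !mxE; case: (odd k) => //.
exact: addF2K.
Qed.

Lemma sum_interleave (V : nmodType) (P : pred 'rV['F_2]_N2) (F : 'rV['F_2]_N2 -> V) :
  \sum_(v | P v) F v = \sum_(x | P (interleave x.1 x.2)) F (interleave x.1 x.2).
Proof.
rewrite (reindex (fun x => interleave x.1 x.2)) //=.
exists (fun v => (minus_part v, plus_part v)) => [[a b] _|v _] /=.
  by rewrite minus_part_interleave plus_part_interleave.
exact: interleave_parts.
Qed.

Lemma arikan_low i j : arikan_mx n.+1 i (low_pos j) = arikan_mx n (half_pos i) j.
Proof.
rewrite !arikan_mxE /= divn_small // modn_small //.
by rewrite leq0n mul1r.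
Qed.

Lemma arikan_high i j :
  arikan_mx n.+1 i (high_pos j) = (odd i)%:R * arikan_mx n (half_pos i) j.
Proof.
rewrite !arikan_mxE /= divnDl ?dvdnn // divnn expn_gt0 /= divn_small //.
rewrite modnDl modn_small //; congr (_%:R * _).
by case: (odd i).
Qed.

Lemma encode_low v j :
  (v *m arikan_mx n.+1) 0 (low_pos j) = (minus_part v *m arikan_mx n) 0 j.
Proof.
rewrite [LHS]mxE [RHS]mxE big_even_odd; apply: eq_bigr => k _.
by rewrite !arikan_low half_even_pos half_odd_pos [minus_part v 0 _]mxE mulrDl.
Qed.

Lemma encode_high v j :
  (v *m arikan_mx n.+1) 0 (high_pos j) = (plus_part v *m arikan_mx n) 0 j.
Proof.
rewrite [LHS]mxE [RHS]mxE big_even_odd; apply: eq_bigr => k _.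
rewrite !arikan_high half_even_pos half_odd_pos [plus_part v 0 _]mxE /= odd_double /=.
by rewrite mul0r mulr0 add0r mul1r.
Qed.

Variable Y : finType.
Implicit Types (y : {ffun 'I_N2 -> Y}) (z : {ffun 'I_N -> Y}).

Definition low_half y : {ffun 'I_N -> Y} := [ffun k => y (low_pos k)].
Definition high_half y : {ffun 'I_N -> Y} := [ffun k => y (high_pos k)].
Definition cat_ffun z z' : {ffun 'I_N2 -> Y} :=
  [ffun k : 'I_N2 => if (k < N)%N then z (mod_pos k) else z' (mod_pos k)].

Lemma cat_ffun_low z z' j : cat_ffun z z' (low_pos j) = z j.
Proof. by rewrite ffunE /= ltn_ord mod_low_pos. Qed.

Lemma cat_ffun_high z z' j : cat_ffun z z' (high_pos j) = z' j.
Proof. by rewrite ffunE /= ltnNge leq_addr mod_high_pos. Qed.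

Lemma sum_cat_ffun (V : nmodType) (F : {ffun 'I_N2 -> Y} -> V) :
  \sum_y F y = \sum_x F (cat_ffun x.1 x.2).
Proof.
rewrite (reindex (fun x => cat_ffun x.1 x.2)) //=.
exists (fun y => (low_half y, high_half y)) => [[z z'] _|y _] /=.
  by congr (_, _); apply/ffunP=> j; rewrite ffunE ?cat_ffun_low ?cat_ffun_high.
apply/ffunP=> k; rewrite ffunE !ffunE [in RHS](mod_posP k).
by case: (k < N)%N.
Qed.

End Halving.

(** * Bhattacharyya parameters of classical channels *)

Section ClassicalPolarization.
Context {R : realType} {Y : finType}.
Variable w : 'F_2 -> Y -> R.
Hypothesis w_ge0 : forall x y, 0 <= w x y.
Hypothesis w_sum : forall x, \sum_y w x y <= 1.

Definition likelihood n (v : 'rV['F_2]_(2 ^ n)) (y : {ffun 'I_(2 ^ n) -> Y}) : R :=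
  \prod_k w ((v *m arikan_mx n) 0 k) (y k).

Definition agree N (i : nat) (u v : 'rV['F_2]_N) : bool :=
  [forall k : 'I_N, (k < i)%N ==> (v 0 k == u 0 k)].

(** Unnormalised output distribution of a synthesized channel: the future bits are summed over, and
    the uniform factors are kept in [weight]. *)
Definition bit_likelihood n (i : 'I_(2 ^ n)) u (b : 'F_2) y : R :=
  \sum_(v | agree i u v && (v 0 i == b)) likelihood v y.

(* [bhatt_term] is summed over whole words u, although it depends only on the first
   i bits of u; the factor 2 ^ (N - i) in the weight compensates for that. *)
Definition weight n (i : 'I_(2 ^ n)) : R := (2 ^+ (2 ^ n - 1 + (2 ^ n - i)))^-1.

Definition bhatt_term n (i : 'I_(2 ^ n)) x : R :=
  Num.sqrt (bit_likelihood i x.1 0 x.2) * Num.sqrt (bit_likelihood i x.1 1 x.2).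

Definition bhatt n (i : 'I_(2 ^ n)) : R := weight i * \sum_x bhatt_term i x.

Lemma likelihood_ge0 n v y : 0 <= @likelihood n v y.
Proof. exact: prodr_ge0. Qed.

Lemma bit_likelihood_ge0 n i u b y : 0 <= @bit_likelihood n i u b y.
Proof. by apply: sumr_ge0 => v _; exact: likelihood_ge0. Qed.

Lemma weight_ge0 n i : 0 <= @weight n i.
Proof. by rewrite invr_ge0 exprn_ge0. Qed.

Lemma bhatt_ge0 n i : 0 <= @bhatt n i.
Proof.
by rewrite mulr_ge0 ?weight_ge0 // sumr_ge0 // => x _; rewrite mulr_ge0 ?sqrtr_ge0.
Qed.

Lemma likelihood_cat n (v : 'rV['F_2]_(2 ^ n.+1)) (z z' : {ffun 'I_(2 ^ n) -> Y}) :
  likelihood v (cat_ffun z z') =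
  likelihood (minus_part v) z * likelihood (plus_part v) z'.
Proof.
rewrite /likelihood big_low_high; congr (_ * _); apply: eq_bigr => k _.
  by rewrite encode_low cat_ffun_low.
by rewrite encode_high cat_ffun_high.
Qed.

Lemma agree_even n (j : 'I_(2 ^ n)) (a b a' b' : 'rV['F_2]_(2 ^ n)) :
  agree (even_pos j) (interleave a b) (interleave a' b') = agree j a a' && agree j b b'.
Proof.
apply/forallP/andP => [h|[/forallP ha /forallP hb] k].
  have hb : agree j b b'.
    apply/forallP=> k; apply/implyP=> kj; have := h (odd_pos k).
    by rewrite !interleave_odd /= ltn_Sdouble kj.
  split=> //; apply/forallP=> k; apply/implyP=> kj; have := h (even_pos k).
  rewrite !interleave_even /= ltn_double kj /=.
  by move/forallP: hb => /(_ k); rewrite kj => /eqP->; rewrite (inj_eq (addIr _)).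
apply/implyP=> /= kj; have kj2 : (half_pos k < j)%N by rewrite /=; lia.
move: (ha (half_pos k)) (hb (half_pos k)); rewrite kj2 => /eqP ea /eqP eb.
by rewrite !mxE ea eb.
Qed.

Lemma agree_odd n (j : 'I_(2 ^ n)) (u v : 'rV['F_2]_(2 ^ n.+1)) :
  agree (odd_pos j) u v =
  agree (even_pos j) u v && (v 0 (even_pos j) == u 0 (even_pos j)).
Proof.
apply/forallP/andP => [h|[/forallP h /eqP e] k].
  split; last by have := h (even_pos j); rewrite /= ltnSn.
  by apply/forallP=> k; apply/implyP=> kj; have := h k; rewrite ltnS ltnW.
apply/implyP; rewrite /= ltnS leq_eqVlt => /orP[/eqP kj|kj]; last by have := h k; rewrite kj.
by rewrite (_ : k = even_pos j) ?e //; apply: val_inj.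
Qed.

(** Once bit 2j is known and bit 2j + 1 is b, both copies have their j-th bit fixed, so no sum over
    a hidden bit remains. *)
Lemma bit_likelihood_odd n (j : 'I_(2 ^ n)) a a' b (z z' : {ffun 'I_(2 ^ n) -> Y}) :
  bit_likelihood (odd_pos j) (interleave a a') b (cat_ffun z z') =
  bit_likelihood j a (a 0 j + a' 0 j + b) z * bit_likelihood j a' b z'.
Proof.
rewrite /bit_likelihood sum_interleave big_distrlr /= pair_big /=.
apply: eq_big => [[v v']|[v v'] _] /=; last first.
  by rewrite likelihood_cat minus_part_interleave plus_part_interleave.
rewrite agree_odd agree_even interleave_odd !interleave_even.
case: (agree j a v); case: (agree j a' v') => //=; rewrite ?andbF //.
case: (eqVneq (v' 0 j) b) => [->|_]; rewrite ?andbF ?andbT //.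
by rewrite -[in RHS](inj_eq (addIr b)) addF2K.
Qed.

(** Bit 2j + 1 is still random here; c is its value, which is also the j-th bit of the second
    copy. *)
Lemma bit_likelihood_even n (j : 'I_(2 ^ n)) a a' b (z z' : {ffun 'I_(2 ^ n) -> Y}) :
  bit_likelihood (even_pos j) (interleave a a') b (cat_ffun z z') =
  \sum_c bit_likelihood j a (b + c) z * bit_likelihood j a' c z'.
Proof.
rewrite /bit_likelihood sum_interleave (partition_big
  (fun x : 'rV['F_2]_(2 ^ n) * 'rV['F_2]_(2 ^ n) => x.2 0 j) predT) //=.
apply: eq_bigr => c _; rewrite big_distrlr /= pair_big /=.
apply: eq_big => [[v v']|[v v'] _] /=; last first.
  by rewrite likelihood_cat minus_part_interleave plus_part_interleave.
rewrite agree_even interleave_even.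
case: (agree j a v); case: (agree j a' v') => //=; rewrite ?andbF //.
case: (eqVneq (v' 0 j) c) => [->|_]; rewrite ?andbF ?andbT //.
by rewrite -[in RHS](inj_eq (addIr c)) addF2K.
Qed.

Lemma weight_odd n (j : 'I_(2 ^ n)) : weight (odd_pos j) = weight j ^+ 2.
Proof.
rewrite /weight exprVn -exprM; congr (_ ^+ _)^-1.
by have := ltn_ord j; rewrite /= expnS; lia.
Qed.

Lemma weight_even n (j : 'I_(2 ^ n)) : weight (even_pos j) = weight j ^+ 2 / 2.
Proof.
rewrite /weight exprVn -exprM -invfM -exprSr; congr (_ ^+ _)^-1.
by have := ltn_ord j; rewrite /= expnS; lia.
Qed.

Lemma sum_interleave_cat n (F : 'rV['F_2]_(2 ^ n.+1) * {ffun 'I_(2 ^ n.+1) -> Y} -> R) :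
  \sum_x F x = \sum_(x : 'rV['F_2]_(2 ^ n) * {ffun 'I_(2 ^ n) -> Y})
    \sum_(x' : 'rV['F_2]_(2 ^ n) * {ffun 'I_(2 ^ n) -> Y})
      F (interleave x.1 x'.1, cat_ffun x.2 x'.2).
Proof.
transitivity (\sum_u \sum_y F (u, y)); first by rewrite pair_bigA; apply: eq_bigr => -[].
rewrite sum_interleave /=.
transitivity (\sum_(u : 'rV['F_2]_(2 ^ n) * 'rV['F_2]_(2 ^ n))
    \sum_(y : {ffun 'I_(2 ^ n) -> Y} * {ffun 'I_(2 ^ n) -> Y})
    F (interleave u.1 u.2, cat_ffun y.1 y.2)).
  by apply: eq_bigr => u _; exact: sum_cat_ffun.
rewrite pair_bigA /= [RHS]pair_bigA /=.
rewrite (reindex (fun q => ((q.1.1, q.2.1), (q.1.2, q.2.2)))) //=.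
by exists (fun q => ((q.1.1, q.2.1), (q.1.2, q.2.2))) => [[[? ?] [? ?]]|[[? ?] [? ?]]].
Qed.

(** The known bit at position 2j at most exchanges the two hypotheses in the first copy. The
    Bhattacharyya term is symmetric in them, so the double sum factors. *)
Lemma bhatt_odd n (j : 'I_(2 ^ n)) : bhatt (odd_pos j) = bhatt j ^+ 2.
Proof.
rewrite /bhatt sum_interleave_cat weight_odd exprMn; congr (_ * _).
rewrite expr2 big_distrlr /=; apply: eq_bigr => x _; apply: eq_bigr => x' _.
rewrite /bhatt_term /= !bit_likelihood_odd.
rewrite !sqrtrM ?bit_likelihood_ge0 // addr0.
have : x.1 0 j + x'.1 0 j = 0 \/ x.1 0 j + x'.1 0 j = 1.
  by case: (_ + _) => [[|[|//]] ?]; [left|right]; apply: val_inj.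
case=> ->; first by rewrite add0r; ring.
have -> : 1 + 1 = 0 :> 'F_2 by exact: val_inj.
ring.
Qed.

(** Pointwise source of the bound 2z - z^2. In terms of the square roots p, q, r, s, the squares of
    the two sides differ by 2pqrs (p - q)^2 (r - s)^2; the right side is first shown nonnegative so
    that squares can be compared. *)
Lemma arikan_minus_le (a b c d : R) : 0 <= a -> 0 <= b -> 0 <= c -> 0 <= d ->
  Num.sqrt (a * c + b * d) * Num.sqrt (b * c + a * d) <=
  (a + b) * (Num.sqrt c * Num.sqrt d) + (c + d) * (Num.sqrt a * Num.sqrt b)
  - 2 * (Num.sqrt a * Num.sqrt b) * (Num.sqrt c * Num.sqrt d).
Proof.
move=> a0 b0 c0 d0; rewrite -sqrtrM ?addr_ge0 ?mulr_ge0 //.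
set p := Num.sqrt a; set q := Num.sqrt b; set r := Num.sqrt c; set s := Num.sqrt d.
have [p0 q0 r0 s0] : [/\ 0 <= p, 0 <= q, 0 <= r & 0 <= s] by rewrite !sqrtr_ge0.
rewrite -(sqr_sqrtr a0) -(sqr_sqrtr b0) -(sqr_sqrtr c0) -(sqr_sqrtr d0) -/p -/q -/r -/s.
set t := (X in _ <= X).
have t0 : 0 <= t.
  have -> : t = r * s * (p - q) ^+ 2 + (r ^+ 2 + s ^+ 2) * (p * q) by rewrite /t; ring.
  by rewrite addr_ge0 // mulr_ge0 ?sqr_ge0 ?mulr_ge0 // addr_ge0 ?sqr_ge0.
rewrite -(ger0_norm t0) -sqrtr_sqr ler_wsqrtr // -subr_ge0.
have -> : t ^+ 2 - (p ^+ 2 * r ^+ 2 + q ^+ 2 * s ^+ 2) * (q ^+ 2 * r ^+ 2 + p ^+ 2 * s ^+ 2)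
  = 2 * (p * q * r * s) * ((p - q) ^+ 2 * (r - s) ^+ 2) by rewrite /t; ring.
by do ?[exact: sqr_ge0 | apply: mulr_ge0].
Qed.

Lemma sumF2 (V : nmodType) (F : 'F_2 -> V) : \sum_b F b = F 0 + F 1.
Proof.
rewrite !big_ord_recl big_ord0 addr0; congr (F _ + F _); exact: val_inj.
Qed.

Lemma sum_word (V : nmodType) N (i : 'I_N) (F : 'rV['F_2]_N -> V) :
  \sum_v F v = \sum_(p : i.-tuple 'F_2) \sum_b
    \sum_(f : (N - i.+1).-tuple 'F_2) F (word p b f).
Proof.
transitivity (\sum_(q : i.-tuple 'F_2 * ('F_2 * (N - i.+1).-tuple 'F_2))
    F (word q.1 q.2.1 q.2.2)); last first.
  rewrite -(pair_bigA _ (fun p q => F (word p q.1 q.2))); apply: eq_bigr => p _.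
  by rewrite (pair_bigA _ (fun b f => F (word p b f))).
pose s (v : 'rV['F_2]_N) := [seq v 0 k | k <- enum 'I_N].
have ss v : size (s v) = N by rewrite size_map size_enum_ord.
have sizep v : size (take i (s v)) == i by rewrite size_take ss ltn_ord.
have sizef v : size (drop i.+1 (s v)) == (N - i.+1)%N by rewrite size_drop ss.
have snth v (k : 'I_N) : nth 0 (s v) k = v 0 k.
  by rewrite (nth_map i) ?size_enum_ord // nth_ord_enum.
rewrite (reindex (fun q : i.-tuple 'F_2 * ('F_2 * (N - i.+1).-tuple 'F_2) =>
  word q.1 q.2.1 q.2.2)) //=.
exists (fun v => (Tuple (sizep v), (v 0 i, Tuple (sizef v)))).
  move=> [p [b f]] _ /=.
  have es : s (word p b f) = p ++ b :: f.
    apply: (@eq_from_nth _ 0) => [|k].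
      by rewrite ss size_cat /= !size_tuple; have := ltn_ord i; lia.
    by rewrite ss => kN; rewrite (snth _ (Ordinal kN)) mxE.
  congr (_, (_, _)); try apply: val_inj => /=.
  - by rewrite es take_size_cat // size_tuple.
  - by rewrite -snth es nth_cat size_tuple ltnn subnn.
  by rewrite es drop_cat size_tuple ltnNge leqnSn /= subSnn /= drop0.
move=> v _; apply/rowP=> k; rewrite mxE /= -(snth v k) -(snth v i).
by rewrite -drop_nth ?ss // cat_take_drop.
Qed.

Lemma word_prefix N (i : 'I_N) p b f (k : 'I_N) :
  (k < i)%N -> @word N i p b f 0 k = nth 0 p k.
Proof. by move=> ki; rewrite mxE nth_cat size_tuple ki. Qed.

Lemma word_bit N (i : 'I_N) p b f : @word N i p b f 0 i = b.
Proof. by rewrite mxE nth_cat size_tuple ltnn subnn. Qed.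

Lemma agree_word N (i : 'I_N) p b f p' b' f' :
  agree i (@word N i p b f) (@word N i p' b' f') = (p' == p).
Proof.
apply/forallP/eqP => [h|-> k]; last by apply/implyP=> ki; rewrite !word_prefix.
apply: eq_from_tnth => k; have kN : (k < N)%N by apply: ltn_trans (ltn_ord i).
have := h (Ordinal kN); rewrite !word_prefix //= ltn_ord => /eqP.
by rewrite -!tnth_nth.
Qed.

Lemma bit_likelihood_word n (i : 'I_(2 ^ n)) p b0 f0 b y :
  bit_likelihood i (@word _ i p b0 f0) b y = \sum_f likelihood (@word _ i p b f) y.
Proof.
rewrite /bit_likelihood big_mkcond (sum_word i) (bigD1 p) //=.
rewrite [X in _ + X]big1 ?addr0 => [|p' pp']; last first.
  rewrite big1 // => b' _; rewrite big1 // => f _.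
  by rewrite agree_word (negbTE pp').
rewrite (bigD1 b) //= [X in _ + X]big1 ?addr0 => [|b' bb']; last first.
  by rewrite big1 // => f _; rewrite word_bit (negbTE bb') andbF.
by apply: eq_bigr => f _; rewrite agree_word word_bit !eqxx.
Qed.

(** A prefix is shared by 2^(N - i) words, which cancels the excess in [weight]. In this form the
    parameter bounds the fidelity of a synthesized channel. *)
Lemma bhatt_wordE n (i : 'I_(2 ^ n)) :
  bhatt i = (2 ^+ (2 ^ n - 1))^-1 * \sum_(p : i.-tuple 'F_2) \sum_y
    Num.sqrt (\sum_f likelihood (@word _ i p 0 f) y) *
    Num.sqrt (\sum_f likelihood (@word _ i p 1 f) y).
Proof.
rewrite /bhatt -(pair_bigA _ (fun u y => bhatt_term i (u, y))) (sum_word i) /=.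
pose F (p : i.-tuple 'F_2) := \sum_y
  Num.sqrt (\sum_f likelihood (@word _ i p 0 f) y) *
  Num.sqrt (\sum_f likelihood (@word _ i p 1 f) y).
transitivity (weight i * \sum_p F p * 2 ^+ (2 ^ n - i)).
  congr (_ * _); apply: eq_bigr => p _.
  transitivity (\sum_(b : 'F_2) \sum_(f : (2 ^ n - i.+1).-tuple 'F_2) F p).
    apply: eq_bigr => b _; apply: eq_bigr => f _; apply: eq_bigr => y _.
    by rewrite /bhatt_term /= !bit_likelihood_word.
  rewrite !sumr_const card_tuple card_ord -mulrnA -[LHS]mulr_natr; congr (_ * _).
  rewrite natrM natrX -exprSr; congr (_ ^+ _); have := ltn_ord i; lia.
rewrite -mulr_suml mulrCA mulrC; congr (_ * _).
by rewrite /weight exprD invfM -mulrA mulVf ?mulr1 // expf_neq0 // pnatr_eq0.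
Qed.

Lemma likelihood_sum_le n v : \sum_y @likelihood n v y <= 1.
Proof.
rewrite /likelihood -(bigA_distr_bigA (fun k => w ((v *m arikan_mx n) 0 k))) /=.
by apply: prodr_ile1 => k _; rewrite w_sum sumr_ge0.
Qed.

(** All 2^N words together have mass at most 2^N, and each prefix is repeated 2^(N - i) times; after
    [weight] this leaves 2, one unit per value of bit i. *)
Lemma bit_likelihood_mass n (i : 'I_(2 ^ n)) :
  weight i * \sum_x (bit_likelihood i x.1 0 x.2 + bit_likelihood i x.1 1 x.2) <= 2.
Proof.
rewrite -(pair_bigA _ (fun u y => bit_likelihood i u 0 y + bit_likelihood i u 1 y)) /=.
rewrite (sum_word i) /=.
pose F (p : i.-tuple 'F_2) :=
  \sum_b \sum_(f : (2 ^ n - i.+1).-tuple 'F_2) \sum_y likelihood (word p b f) y.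
have -> : \sum_p \sum_b \sum_f \sum_y
    (bit_likelihood i (@word _ i p b f) 0 y + bit_likelihood i (word p b f) 1 y) =
    \sum_p F p * 2 ^+ (2 ^ n - i).
  apply: eq_bigr => p _.
  transitivity (\sum_(b : 'F_2) \sum_(f : (2 ^ n - i.+1).-tuple 'F_2) F p).
    apply: eq_bigr => b _; apply: eq_bigr => f _.
    rewrite /F; under [RHS]eq_bigr do rewrite exchange_big.
    rewrite exchange_big; apply: eq_bigr => y _.
    by rewrite !bit_likelihood_word sumF2.
  rewrite !sumr_const card_tuple card_ord -mulrnA -[LHS]mulr_natr; congr (_ * _).
  rewrite natrM natrX -exprSr; congr (_ ^+ _); have := ltn_ord i; lia.
rewrite -mulr_suml -(sum_word i (fun v => \sum_y likelihood v y)).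
apply: le_trans (_ : weight i * (2 ^+ (2 ^ n) * 2 ^+ (2 ^ n - i)) <= _).
  rewrite ler_wpM2l ?weight_ge0 // ler_wpM2r ?exprn_ge0 //.
  apply: le_trans (ler_sum _ (fun v _ => likelihood_sum_le v)) _.
  by rewrite sumr_const card_mx card_ord mul1n -natrX.
rewrite mulrC ler_pdivrMr ?exprn_gt0 // -exprD -exprS.
rewrite ler_weXn2l ?ler1n //; have : (0 < 2 ^ n)%N by rewrite expn_gt0.
by lia.
Qed.

(** Sum the pointwise inequality over pairs of outputs: the linear terms give mass times z, and the
    mass is at most 2. *)
Lemma bhatt_even n (j : 'I_(2 ^ n)) :
  bhatt (even_pos j) <= 2 * bhatt j - bhatt j ^+ 2.
Proof.
pose m (x : 'rV['F_2]_(2 ^ n) * {ffun 'I_(2 ^ n) -> Y}) :=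
  bit_likelihood j x.1 0 x.2 + bit_likelihood j x.1 1 x.2.
have f11 : 1 + 1 = 0 :> 'F_2 by exact: val_inj.
apply: (@le_trans _ _ (weight j ^+ 2 / 2 * \sum_x \sum_x'
    (m x * bhatt_term j x' + m x' * bhatt_term j x
     - 2 * bhatt_term j x * bhatt_term j x'))).
  rewrite /bhatt sum_interleave_cat weight_even.
  rewrite ler_wpM2l ?divr_ge0 ?exprn_ge0 ?weight_ge0 //.
  apply: ler_sum => x _; apply: ler_sum => x' _.
  rewrite {1}/bhatt_term /= !bit_likelihood_even !sumF2 !add0r addr0 f11.
  by apply: arikan_minus_le; apply: bit_likelihood_ge0.
have -> : \sum_x \sum_x' (m x * bhatt_term j x' + m x' * bhatt_term j x
     - 2 * bhatt_term j x * bhatt_term j x') =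
    2 * (\sum_x m x) * (\sum_x bhatt_term j x) - 2 * (\sum_x bhatt_term j x) ^+ 2.
  transitivity (\sum_x (m x * (\sum_x' bhatt_term j x') +
     (\sum_x' m x') * bhatt_term j x
     - 2 * bhatt_term j x * \sum_x' bhatt_term j x')).
    by apply: eq_bigr => x _; rewrite sumrB big_split /= -!mulr_sumr -mulr_suml.
  rewrite sumrB big_split /= -!mulr_suml -!mulr_sumr; ring.
have h := bit_likelihood_mass j.
have h0 := bhatt_ge0 j; rewrite /bhatt in h0 *.
move: h h0; rewrite -/(m _) -[\sum_x (_ + _)]/(\sum_x m x).
set M := \sum_x m x; set G := \sum_x bhatt_term j x; set c := weight j => h h0.
have -> : c ^+ 2 / 2 * (2 * M * G - 2 * G ^+ 2) = c * M * (c * G) - (c * G) ^+ 2.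
  by field.
by rewrite lerB // ler_wpM2r.
Qed.

Lemma bhatt_init (i : 'I_(2 ^ 0)) :
  bhatt i = \sum_y Num.sqrt (w 0 y) * Num.sqrt (w 1 y).
Proof.
have i0 : i = ord0 by apply: val_inj; case: i => [[]].
have lik b (y : {ffun 'I_(2 ^ 0) -> Y}) (p : i.-tuple 'F_2) :
    \sum_f likelihood (@word _ i p b f) y = w b (y ord0).
  have sz : (2 ^ 0 - i.+1 = 0)%N by rewrite i0.
  rewrite (eq_bigr (fun _ => w b (y ord0))) => [|f _].
    by rewrite sumr_const card_tuple sz; exact: mulr1n.
  rewrite /likelihood big_ord1; congr (w _ _).
  rewrite mxE big_ord1 arikan_mxE mulr1.
  by rewrite -[RHS](word_bit p b f); congr (word _ _ _ _ _); rewrite i0.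
rewrite bhatt_wordE subnn expr0 invr1 mul1r.
rewrite (eq_bigr (fun _ => \sum_y Num.sqrt (w 0 y) * Num.sqrt (w 1 y))) => [|p _].
  by rewrite sumr_const card_tuple {1}i0; exact: mulr1n.
rewrite (reindex (fun y : Y => [ffun _ : 'I_(2 ^ 0) => y])) /=.
  by apply: eq_bigr => y _; rewrite !lik !ffunE.
exists (fun y : {ffun 'I_(2 ^ 0) -> Y} => y ord0) => [y _|y _]; first by rewrite ffunE.
by apply/ffunP=> k; rewrite ffunE; congr (y _); apply: val_inj; case: k => [[]].
Qed.

End ClassicalPolarization.

(** * Transposed encoding as reversal of the index order *)

Section PhaseReversal.
Context {R : realType} {Y : finType}.
Variable w : 'F_2 -> Y -> R.

Definition likelihood_tr n (v : 'rV['F_2]_(2 ^ n)) (y : {ffun 'I_(2 ^ n) -> Y}) : R :=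
  \prod_k w ((v *m (arikan_mx n)^T) 0 k) (y k).

Definition rev_row N (v : 'rV['F_2]_N) : 'rV['F_2]_N := \row_j v 0 (rev_ord j).

Definition rev_ffun N (y : {ffun 'I_N -> Y}) : {ffun 'I_N -> Y} :=
  [ffun k => y (rev_ord k)].

Lemma rev_ffunK N : involutive (@rev_ffun N).
Proof. by move=> y; apply/ffunP=> k; rewrite !ffunE rev_ordK. Qed.

Lemma likelihood_trE n v y :
  @likelihood_tr n v y = likelihood w (rev_row v) (rev_ffun y).
Proof.
rewrite /likelihood (reindex_inj rev_ord_inj) /=; apply: eq_bigr => k _.
rewrite ffunE rev_ordK; congr (w _ _); rewrite [LHS]mxE [RHS]mxE.
rewrite (reindex_inj rev_ord_inj) /=; apply: eq_bigr => j _.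
by rewrite mxE [rev_row v 0 j]mxE arikan_mx_rev rev_ordK.
Qed.

(** Reversal exchanges previous and future bits. The cast is there because the lengths i and N - (N
    - i - 1) - 1 are equal only propositionally. *)
Lemma rev_row_word N (i : 'I_N) (p : i.-tuple 'F_2) b (f : (N - i.+1).-tuple 'F_2)
    (e : i = (N - (rev_ord i).+1)%N :> nat) :
  rev_row (word p b f) =
  @word N (rev_ord i) [tuple of rev f] b (tcast e [tuple of rev p]).
Proof.
have sz : size (p ++ b :: f) = N.
  by rewrite size_cat /= !size_tuple; have := ltn_ord i; lia.
apply/rowP=> k; rewrite !mxE val_tcast /= -[in RHS]cat_rcons -rev_cons -rev_cat nth_rev sz //.
Qed.

(** Reversing words and outputs undoes the transposition and trades known future bits for known
    previous ones, at the mirrored index. *)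
Lemma bhatt_rev_wordE n (i : 'I_(2 ^ n)) :
  bhatt w (rev_ord i) = (2 ^+ (2 ^ n - 1))^-1 *
    \sum_(f : (2 ^ n - i.+1).-tuple 'F_2) \sum_y
      Num.sqrt (\sum_p likelihood_tr (@word _ i p 0 f) y) *
      Num.sqrt (\sum_p likelihood_tr (@word _ i p 1 f) y).
Proof.
rewrite bhatt_wordE; congr (_ * _).
have e : i = (2 ^ n - (rev_ord i).+1)%N :> nat by have := ltn_ord i; rewrite /=; lia.
have rev_inj m : injective (fun t : m.-tuple 'F_2 => [tuple of rev t]).
  by move=> s t /(congr1 val) /= h; apply: val_inj; apply: (can_inj revK).
rewrite (reindex_inj (@rev_inj (2 ^ n - i.+1)%N)) /=; apply: eq_bigr => f _.
rewrite (reindex_inj (inv_inj (@rev_ffunK (2 ^ n)))) /=; apply: eq_bigr => y _.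
have h b : \sum_f' likelihood w (@word _ (rev_ord i) [tuple of rev f] b f') (rev_ffun y) =
    \sum_p likelihood_tr (@word _ i p b f) y.
  have bij : bijective (fun p : i.-tuple 'F_2 => tcast e [tuple of rev p]).
    exists (fun f' => [tuple of rev (tcast (esym e) f')]) => t;
      by apply: val_inj; rewrite /= !val_tcast /= ?val_tcast ?revK.
  rewrite (reindex _ (onW_bij _ bij)) /=; apply: eq_bigr => p _.
  by rewrite likelihood_trE (rev_row_word p b f e).
by rewrite -!h.
Qed.

End PhaseReversal.

(** * Measuring the synthesized channels *)

Section TensorGeneric.
Context {C : numClosedFieldType}.

Lemma ctrmx_tens m n p q (A : 'M[C]_(m, n)) (B : 'M[C]_(p, q)) :
  (A *t B)^t* = A^t* *t B^t*.
Proof. by apply/matrixP=> i j; rewrite !mxE rmorphM. Qed.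

Lemma tensmx_suml m n p q I (r : seq I) (F : I -> 'M[C]_(m, n)) (B : 'M[C]_(p, q)) :
  (\sum_(k <- r) F k) *t B = \sum_(k <- r) F k *t B.
Proof.
apply/matrixP=> i j; rewrite summxE !mxE summxE mulr_suml.
by apply: eq_bigr => k _; rewrite mxE.
Qed.

Lemma tensmx_sumr m n p q I (r : seq I) (A : 'M[C]_(m, n)) (F : I -> 'M[C]_(p, q)) :
  A *t (\sum_(k <- r) F k) = \sum_(k <- r) A *t F k.
Proof.
apply/matrixP=> i j; rewrite summxE !mxE summxE mulr_sumr.
by apply: eq_bigr => k _; rewrite mxE.
Qed.

Lemma tensmx11 m n : (1%:M : 'M[C]_m) *t (1%:M : 'M[C]_n) = 1%:M.
Proof.
apply/matrixP=> i j; case: (mxtens_indexP i) => i1 i2; case: (mxtens_indexP j) => j1 j2.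
rewrite tensmxE !mxE -natrM mulnb; congr (_%:R).
by rewrite (inj_eq (can_inj (@mxtens_indexK m n))).
Qed.

Lemma tens_dot m n (u : 'cV[C]_m) (v : 'cV[C]_n) (A : 'M[C]_m) (B : 'M[C]_n) :
  ((u *t v)^t* *m (A *t B) *m (u *t v)) 0 0 =
  (u^t* *m A *m u) 0 0 * (v^t* *m B *m v) 0 0.
Proof.
by rewrite ctrmx_tens !tensmx_mul [LHS]mxE !ord1.
Qed.

Lemma tens_outer m n (u : 'cV[C]_m) (v : 'cV[C]_n) :
  (u *t v) *m (u *t v)^t* = (u *m u^t*) *t (v *m v^t*).
Proof. by rewrite ctrmx_tens tensmx_mul. Qed.

Lemma sum_enum_ffun N d (F : 'I_N -> 'I_d -> C) :
  \sum_(a < #|{: {ffun 'I_N -> 'I_d}}|) \prod_k F k ((enum_val a : {ffun 'I_N -> 'I_d}) k) =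
  \prod_k \sum_j F k j.
Proof.
rewrite bigA_distr_bigA /= [RHS](reindex_onto enum_val enum_rank) /=; last first.
  by move=> y _; rewrite enum_rankK.
by apply: eq_bigl => a; rewrite enum_valK eqxx.
Qed.

End TensorGeneric.

Section Tensor.
Context {R : realType}.
Local Notation C := R[i].
Variables d N : nat.
Local Notation ix := #|{: {ffun 'I_N -> 'I_d}}|.

Lemma tensN_mul (A B : 'I_N -> 'M[C]_d) :
  tensN A *m tensN B = tensN (fun k => A k *m B k).
Proof.
apply/matrixP=> a c; rewrite [LHS]mxE [RHS]mxE.
under [RHS]eq_bigr do rewrite mxE.
rewrite -(sum_enum_ffun (fun k j => A k ((enum_val a : {ffun 'I_N -> 'I_d}) k) j *
  B k j ((enum_val c : {ffun 'I_N -> 'I_d}) k))).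
by apply: eq_bigr => e _; rewrite mxE [X in _ * X]mxE -big_split.
Qed.

Lemma tensN_adj (A : 'I_N -> 'M[C]_d) :
  (tensN A)^t* = tensN (fun k => (A k)^t*).
Proof.
apply/matrixP=> a c; rewrite [LHS]mxE [RHS]mxE.
under [RHS]eq_bigr do rewrite mxE.
by rewrite !mxE rmorph_prod; apply: eq_bigr => k _; rewrite mxE.
Qed.

(** Tensoring the square roots exhibits the product as a Gram matrix. *)
Lemma psdmx_tensN (A : 'I_N -> 'M[C]_d) :
  (forall k, psdmx (A k)) -> psdmx (tensN A).
Proof.
move=> hA.
have -> : tensN A = (tensN (fun k => sqrtm (A k)))^t* *m tensN (fun k => sqrtm (A k)).
  rewrite tensN_adj tensN_mul; congr tensN; apply: funext => k.
  by rewrite (psd_adj (psd_sqrtm (hA k))) (sqrtmK (hA k)).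
exact: psd_gram.
Qed.

Variable b : 'I_d -> 'cV[C]_d.
Hypothesis hb : is_measurement b.

Definition tensor_ket (y : {ffun 'I_N -> 'I_d}) : 'cV[C]_ix :=
  \col_a \prod_k b (y k) ((enum_val a : {ffun 'I_N -> 'I_d}) k) 0.

Lemma tensor_measurement : is_measurement tensor_ket.
Proof.
rewrite /is_measurement; apply/matrixP=> a c; rewrite summxE.
transitivity (\sum_(y : {ffun 'I_N -> 'I_d}) \prod_k
   (b (y k) ((enum_val a : {ffun 'I_N -> 'I_d}) k) 0 *
    (b (y k) ((enum_val c : {ffun 'I_N -> 'I_d}) k) 0)^*)).
  apply: eq_bigr => y _; rewrite mxE big_ord1 !mxE rmorph_prod -big_split.
  by apply: eq_bigr.
rewrite -(bigA_distr_bigA (fun k j => b j ((enum_val a : {ffun 'I_N -> 'I_d}) k) 0 *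
    (b j ((enum_val c : {ffun 'I_N -> 'I_d}) k) 0)^*)) /=.
transitivity (\prod_k (((enum_val a : {ffun 'I_N -> 'I_d}) k ==
    (enum_val c : {ffun 'I_N -> 'I_d}) k)%:R : C)).
  apply: eq_bigr => k _; have /matrixP/(_ ((enum_val a : {ffun 'I_N -> 'I_d}) k)
    ((enum_val c : {ffun 'I_N -> 'I_d}) k)) := hb.
  rewrite summxE [RHS]mxE => <-; apply: eq_bigr => j _.
  by rewrite mxE big_ord1 !mxE.
rewrite mxE; case: (eqVneq a c) => [->|ac]; first by rewrite big1 // => k _; rewrite eqxx.
have : enum_val a != enum_val c by rewrite (inj_eq enum_val_inj).
move=> h; have /existsP[k hk] : [exists k, (enum_val a : {ffun 'I_N -> 'I_d}) k !=
    (enum_val c : {ffun 'I_N -> 'I_d}) k].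
  apply: contraNT h; rewrite negb_exists => /forallP h; apply/eqP/ffunP=> k.
  by have := h k; rewrite negbK => /eqP.
by rewrite (bigD1 k) //= (negbTE hk) mul0r.
Qed.

Lemma tensor_ket_dot (A : 'I_N -> 'M[C]_d) y :
  ((tensor_ket y)^t* *m tensN A *m tensor_ket y) 0 0 =
  \prod_k ((b (y k))^t* *m A k *m b (y k)) 0 0.
Proof.
rewrite mxE; under [RHS]eq_bigr do rewrite mxE.
rewrite -(sum_enum_ffun (fun k j => ((b (y k))^t* *m A k) 0 j * b (y k) j 0)).
apply: eq_bigr => a _; rewrite big_split /= [X in _ * X]mxE; congr (_ * _).
rewrite mxE; under [RHS]eq_bigr do rewrite mxE.
rewrite -(sum_enum_ffun (fun k j => (b (y k))^t* 0 j *
   A k j ((enum_val a : {ffun 'I_N -> 'I_d}) k))).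
apply: eq_bigr => c _; rewrite big_split /=; congr (_ * _); last by rewrite mxE.
rewrite !mxE rmorph_prod; apply: eq_bigr => k _.
by rewrite !mxE.
Qed.

Lemma expect_tensN (A : 'I_N -> 'M[C]_d) y : (forall k, psdmx (A k)) ->
  expect (tensN A) (tensor_ket y) = \prod_k expect (A k) (b (y k)).
Proof.
move=> hA; rewrite /expect tensor_ket_dot.
rewrite (eq_bigr (fun k => real_complex R (expect (A k) (b (y k))))) => [|k _].
  by rewrite -rmorph_prod.
by rewrite RRe_real // ger0_real // hA.
Qed.

End Tensor.

Lemma mul_sqrtM (R : realType) (c1 c2 x y : R) : 0 <= c1 -> 0 <= c2 ->
  Num.sqrt (c1 * (c2 * x)) * Num.sqrt (c1 * (c2 * y)) =
  c1 * c2 * (Num.sqrt x * Num.sqrt y).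
Proof.
move=> h1 h2; have c0 := mulr_ge0 h1 h2.
by rewrite !mulrA !(sqrtrM _ c0) mulrACA -expr2 sqr_sqrtr // mulrA.
Qed.

(** * Fidelity bound for product outputs with classical side information *)

Section SynthesizedFidelity.
Context {R : realType}.
Local Notation C := R[i].
Variables (d N k m : nat) (c1 c2 : R).
Variables (A : 'F_2 -> k.-tuple 'F_2 -> m.-tuple 'F_2 -> 'I_N -> 'M[C]_d).
Hypothesis hA : forall u p f j, psdmx (A u p f j).
Hypotheses (c1_ge0 : 0 <= c1) (c2_ge0 : 0 <= c2).
Variable b : 'I_d -> 'cV[C]_d.
Hypothesis hb : is_measurement b.

(** Common shape of both synthesized channels: p is the register that the receiver holds, f the bits
    averaged over. These are past and future for the amplitude channel, future and past for the
    phase channel. *)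
Definition side_info_state u :=
  \sum_(p : k.-tuple 'F_2) real_complex R c1 *: (@register R k p *t
    \sum_(f : m.-tuple 'F_2) real_complex R c2 *: tensN (A u p f)).

(** Reads the register in its own basis and measures every output separately with [b]. *)
Definition side_info_ket (q : k.-tuple 'F_2 * {ffun 'I_N -> 'I_d}) :
    'cV[C]_(#|{: k.-tuple 'F_2}| * #|{: {ffun 'I_N -> 'I_d}}|) :=
  (delta_mx (enum_rank q.1) 0 : 'cV[C]_#|{: k.-tuple 'F_2}|) *t tensor_ket b q.2.

Lemma ctrmx_delta m1 m2 i j : (delta_mx i j : 'M[C]_(m1, m2))^t* = delta_mx j i.
Proof. by rewrite trmx_delta; apply/matrixP=> a c; rewrite !mxE; exact: rmorph_nat. Qed.

Lemma side_info_measurement : is_measurement side_info_ket.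
Proof.
have e1 : \sum_(p : k.-tuple 'F_2) (delta_mx (enum_rank p) 0 : 'cV[C]_#|{: k.-tuple 'F_2}|)
    *m (delta_mx (enum_rank p) 0)^t* = 1%:M.
  apply/matrixP=> i j; rewrite summxE [RHS]mxE.
  rewrite (bigD1 (enum_val i)) //= big1 => [|p pi].
    by rewrite ctrmx_delta mul_delta_mx mxE enum_valK eqxx addr0 eq_sym.
  rewrite ctrmx_delta mul_delta_mx mxE; case: eqP => [e|//] /=.
  by case/negP: pi; rewrite e enum_rankK.
rewrite /is_measurement -tensmx11 -e1 -(tensor_measurement N hb) tensmx_suml.
rewrite -(pair_bigA _ (fun p y => side_info_ket (p, y) *m (side_info_ket (p, y))^t*)) /=.
apply: eq_bigr => p _; rewrite tensmx_sumr; apply: eq_bigr => y _.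
exact: tens_outer.
Qed.

Lemma psdmx_side_info u : psdmx (side_info_state u).
Proof.
apply: psd_sum => p; apply: psdZ; first by rewrite ler0c.
set X := \sum_f _; have hX : psd X.
  by apply: psd_sum => f; apply: psdZ; [rewrite ler0c|exact: psdmx_tensN].
have -> : register p *t X = (register p *t sqrtm X)^t* *m (register p *t sqrtm X).
  rewrite ctrmx_tens tensmx_mul (psd_adj (psd_sqrtm hX)) (sqrtmK hX).
  by rewrite /register ctrmx_delta mul_delta_mx.
exact: psd_gram.
Qed.

Lemma expect_side_info u p y :
  expect (side_info_state u) (side_info_ket (p, y)) =
  c1 * (c2 * \sum_f \prod_j expect (A u p f j) (b (y j))).
Proof.
rewrite expect_sum (bigD1 p) //= [X in _ + X]big1 ?addr0 => [|p' pp'].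
  rewrite expectZ /side_info_ket {1}/expect [X in complex.Re X]tens_dot /=.
  rewrite {1}/register -mulmxA mul_delta_mx ctrmx_delta mul_delta_mx mxE !eqxx mul1r.
  congr (_ * _); rewrite -/(expect _ _) expect_sum mulr_sumr; apply: eq_bigr => f _.
  by rewrite expectZ expect_tensN.
rewrite expectZ /side_info_ket /expect tens_dot /=.
rewrite -mulmxA {1}/register mul_delta_mx_0 ?(inj_eq enum_rank_inj) //.
by rewrite mulmx0 (mxE _ _ (0 : 'I_1) 0) mul0r mulr0.
Qed.

Lemma trnorm_side_info :
  trnorm (sqrtmx (side_info_state 0) *m sqrtmx (side_info_state 1)) <=
  c1 * c2 * \sum_(p : k.-tuple 'F_2) \sum_(y : {ffun 'I_N -> 'I_d})
    Num.sqrt (\sum_f \prod_j expect (A 0 p f j) (b (y j))) *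
    Num.sqrt (\sum_f \prod_j expect (A 1 p f j) (b (y j))).
Proof.
have := trnorm_le_measure side_info_measurement (psdmx_side_info 0) (psdmx_side_info 1).
move=> h; apply: le_trans h _; rewrite pair_bigA mulr_sumr.
apply: ler_sum => -[p y] _ /=.
rewrite (expect_side_info 0 p y) (expect_side_info 1 p y).
by rewrite mul_sqrtM //.
Qed.

End SynthesizedFidelity.

Section MeasuredChannel.
Context {R : realType}.
Local Notation C := R[i].
Variables (d : nat) (W : @cqchannel R d).
Hypothesis hW : forall x, psdmx (W x).
Variable b : 'I_d -> 'cV[C]_d.
Hypothesis hb : is_measurement b.

Definition measured (x : 'F_2) (y : 'I_d) : R := expect (W x) (b y).

Lemma real_complex_exp2V k : real_complex R (2 ^+ k)^-1 = (2 ^+ k)^-1.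
Proof. by rewrite fmorphV rmorphXn rmorph_nat. Qed.

Lemma exp2V_ge0 k : 0 <= (2 ^+ k)^-1 :> R.
Proof. by rewrite invr_ge0 exprn_ge0. Qed.

Lemma exp2V_mul N (i : 'I_N) :
  (2 ^+ i)^-1 * (2 ^+ (N - i.+1))^-1 = (2 ^+ (N - 1))^-1 :> R.
Proof. by rewrite -invfM -exprD; congr (_ ^+ _)^-1; have := ltn_ord i; lia. Qed.

Lemma synth_amplitudeE n (i : 'I_(2 ^ n)) u :
  synth_amplitude W i u = side_info_state (2 ^+ i)^-1 (2 ^+ (2 ^ n - i.+1))^-1
    (fun u (p : i.-tuple 'F_2) (f : (2 ^ n - i.+1).-tuple 'F_2) k =>
       W ((word p u f *m arikan_mx n) 0 k)) u.
Proof. by rewrite /side_info_state !real_complex_exp2V. Qed.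

Lemma synth_phaseE n (i : 'I_(2 ^ n)) u :
  synth_phase W i u = side_info_state (2 ^+ (2 ^ n - i.+1))^-1 (2 ^+ i)^-1
    (fun u (f : (2 ^ n - i.+1).-tuple 'F_2) (p : i.-tuple 'F_2) k =>
       W ((word p u f *m (arikan_mx n)^T) 0 k)) u.
Proof. by rewrite /side_info_state !real_complex_exp2V. Qed.

Lemma sqrt_fidelity_amplitude_le n (i : 'I_(2 ^ n)) :
  Num.sqrt (fidelity (synth_amplitude W i)) <= bhatt measured i.
Proof.
rewrite sqrt_fidelity !synth_amplitudeE bhatt_wordE -(exp2V_mul i).
by apply: trnorm_side_info => // *; exact: exp2V_ge0.
Qed.

Lemma sqrt_fidelity_phase_le n (i : 'I_(2 ^ n)) :
  Num.sqrt (fidelity (synth_phase W i)) <= bhatt measured (rev_ord i).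
Proof.
rewrite sqrt_fidelity !synth_phaseE bhatt_rev_wordE -(exp2V_mul i).
rewrite [(2 ^+ i)^-1 * _]mulrC.
by apply: trnorm_side_info => // *; exact: exp2V_ge0.
Qed.

End MeasuredChannel.

(** * The potential *)

Section Potential.
Context {R : realType}.

Lemma ln2_le1 : ln 2 <= 1 :> R.
Proof. by apply: (@le_ln1Dx R 1); lra. Qed.

(** This is x^(-s) for x > 0. *)
Definition decay (s x : R) : R := expR (- (s * ln x)).

Lemma decay_gt0 s x : 0 < decay s x.
Proof. exact: expR_gt0. Qed.

Lemma decayM s x y : 0 < x -> 0 < y -> decay s (x * y) = decay s x * decay s y.
Proof. by move=> x0 y0; rewrite /decay lnM ?posrE // mulrDr opprD expRD. Qed.

Lemma decay_anti s x y : 0 <= s -> 0 < x -> x <= y -> decay s y <= decay s x.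
Proof.
move=> s0 x0 xy; rewrite /decay ler_expR lerN2 ler_wpM2l // ler_ln ?posrE //.
exact: lt_le_trans xy.
Qed.

Lemma decay_le1 s x : 0 <= s -> 1 <= x -> decay s x <= 1.
Proof.
by move=> s0 x1; have := decay_anti s0 ltr01 x1; rewrite {2}/decay ln1 mulr0 oppr0 expR0.
Qed.

(* The junk value [ln 0 = 0] must not be used at q = 0, where L is infinite. *)
Definition capped_decay (s K q : R) : R :=
  if q == 0 then 0 else decay s (Num.max K (- ln q)).

Lemma capped_decay_ge0 s K q : 0 <= capped_decay s K q.
Proof. by rewrite /capped_decay; case: eqP => // _; rewrite ltW ?decay_gt0. Qed.

Lemma capped_decay_le1 s K q : 0 <= s -> 1 <= K -> capped_decay s K q <= 1.
Proof.
by move=> s0 K1; rewrite /capped_decay; case: eqP => // _; rewrite decay_le1 // le_max K1.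
Qed.

Lemma capped_decay_mono s K q q' : 0 <= s -> 0 < K -> 0 <= q -> q <= q' ->
  capped_decay s K q <= capped_decay s K q'.
Proof.
move=> s0 K0; rewrite le_eqVlt => /orP[/eqP <- _|q0 qq'].
  by rewrite {1}/capped_decay eqxx capped_decay_ge0.
rewrite /capped_decay !gt_eqF //; last exact: lt_le_trans qq'.
apply: decay_anti => //; first by rewrite lt_max K0.
rewrite ge_max le_max lexx /= le_max lerN2 ler_ln ?posrE ?qq' ?orbT //.
exact: lt_le_trans qq'.
Qed.

(** [La] and [Lb] stand for - ln a and - ln p. The arguments on the left are lower bounds for L at
    the two children of q = a p; the 1 pays for a factor at most 2. *)
Lemma decay_step s K (La Lb : R) (L := La + Lb) (x := 1 + K^-1) :
  0 <= s -> 0 < K -> 0 <= La -> 0 <= Lb -> K + 1 <= L ->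
  decay s (L + La - 1) + decay s (L + Lb - 1) <=
  decay s x^-1 * (1 + decay s 2) * decay s L.
Proof.
move=> s0 K0 La0 Lb0 KL.
have L0 : 0 < L by lra.
have x0 : 0 < x by rewrite addr_gt0 ?invr_gt0.
(* As L >= K + 1, dropping the 1 costs at most the factor 1 + 1/K in the argument. *)
have shrink M : 0 <= M -> decay s (L + M - 1) <= decay s x^-1 * decay s (L + M).
  move=> M0; rewrite -decayM ?invr_gt0 //; last by lra.
  apply: decay_anti => //; first by rewrite mulr_gt0 ?invr_gt0 //; lra.
  rewrite mulrC ler_pdivrMr // /x mulrDr mulr1.
  suff : 1 <= (L + M - 1) * K^-1 by lra.
  by rewrite ler_pdivlMr //; lra.
apply: le_trans (lerD (shrink _ La0) (shrink _ Lb0)) _.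
rewrite -mulrDr -mulrA ler_wpM2l ?(ltW (decay_gt0 _ _)) //.
set X := decay s (L + La); set Y := decay s (L + Lb); set Z := decay s L.
have XZ : X <= Z by apply: decay_anti => //; lra.
have YZ : Y <= Z by apply: decay_anti => //; lra.
(* This holds because (L + La)(L + Lb) = 2 L^2 + La Lb. Then (Z - X)(Z - Y) >= 0 gives X + Y <= Z +
   X Y / Z. *)
have XY : X * Y <= decay s 2 * Z * Z.
  rewrite /X /Y /Z -!decayM ?mulr_gt0 //; try lra.
  apply: decay_anti; rewrite ?mulr_gt0 //.
  have : 0 <= La * Lb by rewrite mulr_ge0.
  rewrite /L; nra.
have Z0 : 0 < Z by exact: decay_gt0.
rewrite -(ler_pM2r Z0).
have : 0 <= (Z - X) * (Z - Y) by rewrite mulr_ge0 ?subr_ge0.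
nra.
Qed.

(** The maximum is sqrt 3, reached at a = p = 1/2; 9/5 is a rational bound above it that is still
    below 2. *)
Lemma sqrt_step (a p : R) : 0 <= a -> 0 <= p -> a + p <= 1 ->
  Num.sqrt (p * (2 - a)) + Num.sqrt (a * (2 - p)) <= 9 / 5.
Proof.
move=> a0 p0 ap.
have pa0 : 0 <= p * (2 - a) by rewrite mulr_ge0 //; lra.
have ap0 : 0 <= a * (2 - p) by rewrite mulr_ge0 //; lra.
set x := Num.sqrt _; set y := Num.sqrt _.
have x0 : 0 <= x := sqrtr_ge0 _.
have y0 : 0 <= y := sqrtr_ge0 _.
have x2 : x ^+ 2 = p * (2 - a) by rewrite sqr_sqrtr.
have y2 : y ^+ 2 = a * (2 - p) by rewrite sqr_sqrtr.
have q4 : 4 * (a * p) <= 1.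
  have : 0 <= (a - p) ^+ 2 by exact: sqr_ge0.
  nra.
have q0 : 0 <= a * p by exact: mulr_ge0.
(* AM-GM for x y with weights 3 and 1/3, balanced at a = p = 1/2, where (2 - a)(2 - p) = 9 a p. *)
set t := 3 * (a * p) + (4 - 2 * (a + p) + a * p) / 3.
have t0 : 0 <= t by rewrite /t; lra.
have xy : 2 * (x * y) <= t.
  rewrite -(@ler_pXn2r _ 2) ?nnegrE ?mulr_ge0 //.
  have -> : (2 * (x * y)) ^+ 2 = 4 * (x ^+ 2 * y ^+ 2) by ring.
  rewrite x2 y2 -subr_ge0.
  have -> : t ^+ 2 - 4 * (p * (2 - a) * (a * (2 - p))) =
    (3 * (a * p) - (4 - 2 * (a + p) + a * p) / 3) ^+ 2 by rewrite /t; field.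
  exact: sqr_ge0.
rewrite -(@ler_pXn2r _ 2) ?nnegrE ?addr_ge0 //.
have -> : (x + y) ^+ 2 = x ^+ 2 + y ^+ 2 + 2 * (x * y) by ring.
rewrite x2 y2; rewrite /t in xy; lra.
Qed.

(** If L >= K + 1, [decay_step] applies. Otherwise q > exp (- (K + 1)), so the square-root term is
    at least 2 and dominates the two capped values, each at most 1. If q = 0, both children
    vanish. *)
Lemma capped_decay_step s K (a p qe qo : R) (q := a * p) : 0 <= s -> 1 <= K ->
  0 <= a -> 0 <= p -> a + p <= 1 ->
  0 <= qe <= q * (p * (2 - a)) -> 0 <= qo <= q * (a * (2 - p)) ->
  capped_decay s K qe + capped_decay s K qo <=
  decay s (1 + K^-1)^-1 * (1 + decay s 2) * capped_decay s K q
  + 2 * expR ((K + 1) / 2) * Num.sqrt q.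
Proof.
move=> s0 K1 a0 p0 ap /andP[qe0 qeq] /andP[qo0 qoq].
have K0 : 0 < K by lra.
have coef0 : 0 <= decay s (1 + K^-1)^-1 * (1 + decay s 2).
  by rewrite mulr_ge0 ?addr_ge0 ?(ltW (decay_gt0 _ _)).
have [q0|q0] := eqVneq q 0.
  have -> : qe = 0 by apply/eqP; rewrite eq_le qe0 andbT (le_trans qeq) // q0 mul0r.
  have -> : qo = 0 by apply/eqP; rewrite eq_le qo0 andbT (le_trans qoq) // q0 mul0r.
  have -> : capped_decay s K 0 = 0 by rewrite /capped_decay eqxx.
  by rewrite addr0 addr_ge0 // mulr_ge0 ?capped_decay_ge0 ?sqrtr_ge0 // mulr_ge0 ?expR_ge0.
have a_gt0 : 0 < a.
  rewrite lt_neqAle a0 andbT eq_sym; apply: contraNneq q0 => e.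
  by rewrite /q e mul0r.
have p_gt0 : 0 < p.
  rewrite lt_neqAle p0 andbT eq_sym; apply: contraNneq q0 => e.
  by rewrite /q e mulr0.
have q_gt0 : 0 < q by rewrite mulr_gt0.
have [Lq|Lq] := leP (K + 1) (- ln q); last first.
  have h : 1 <= expR ((K + 1) / 2) * Num.sqrt q.
    rewrite -[leLHS](@expR0 R) -[Num.sqrt q]lnK ?posrE ?sqrtr_gt0 // -expRD ler_expR.
    have : ln q = 2 * ln (Num.sqrt q).
      by rewrite -{1}(sqr_sqrtr (ltW q_gt0)) expr2 lnM ?posrE ?sqrtr_gt0 //; ring.
    by lra.
  have h1 := capped_decay_le1 qe s0 K1; have h2 := capped_decay_le1 qo s0 K1.
  have h3 : 0 <= decay s (1 + K^-1)^-1 * (1 + decay s 2) * capped_decay s K q.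
    by rewrite mulr_ge0 ?capped_decay_ge0.
  rewrite -mulrA; lra.
have lnq : ln q = ln a + ln p by rewrite /q lnM ?posrE.
have La0 : 0 <= - ln a by rewrite oppr_ge0 ln_le0 //; lra.
have Lp0 : 0 <= - ln p by rewrite oppr_ge0 ln_le0 //; lra.
have L : - ln q = - ln a + - ln p by rewrite lnq; ring.
(* A child repeats the factor b and gains a factor 2 - c, which lowers L by at most ln 2 <= 1. *)
have bound (b c r : R) : 0 < b -> 0 < c -> b + c <= 1 -> 0 <= r <= q * (b * (2 - c)) ->
    capped_decay s K r <= decay s (- ln a + - ln p + - ln b - 1).
  move=> b0 c0 bc /andP[r0 rq].
  apply: le_trans (capped_decay_mono s0 K0 r0 rq) _.
  have d0 : 0 < 2 - c by lra.
  have ld : ln (2 - c) <= 1.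
    by apply: le_trans ln2_le1; rewrite ler_ln ?posrE //; lra.
  have b1 : ln b <= 0 by rewrite ln_le0 //; lra.
  rewrite /capped_decay gt_eqF ?mulr_gt0 //; apply: decay_anti => //; first by lra.
  rewrite le_max; apply/orP; right.
  rewrite !lnM ?posrE ?mulr_gt0 //; lra.
have he : capped_decay s K qe <= decay s (- ln a + - ln p + - ln p - 1).
  by apply: (bound p a) => //; [rewrite addrC|rewrite qe0 qeq].
have ho : capped_decay s K qo <= decay s (- ln a + - ln p + - ln a - 1).
  by apply: (bound a p) => //; rewrite qo0 qoq.
have := decay_step s0 K0 La0 Lp0 _; rewrite -L => /(_ Lq) hs.
have -> : capped_decay s K q = decay s (- ln q).
  by rewrite /capped_decay (negbTE q0) max_r //; lra.
have h0 : 0 <= 2 * expR ((K + 1) / 2) * Num.sqrt q.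
  by rewrite !mulr_ge0 ?expR_ge0 ?sqrtr_ge0.
rewrite -L in he ho; lra.
Qed.

(** lam has to exceed (1 + 2^(-s)) / 2 and 9/10 and stay below 2^(- beta s). For small s the first
    is 2^(-s/2) up to a factor 1 + O(s^2), while 2^(- beta s) is larger than 2^(-s/2) by a
    first-order factor, since beta < 1/2. *)
Lemma potential_params (beta : R) : 0 < beta < 1 / 2 ->
  exists s K lam, [/\ 0 < s, 1 <= K, 9 / 10 < lam,
    decay s (1 + K^-1)^-1 * (1 + decay s 2) <= 2 * lam &
    lam * expR (beta * s * ln 2) < 1].
Proof.
move=> /andP[b0 b2].
pose del := 1 / 2 - beta; have d0 : 0 < del by rewrite /del; lra.
(* With h = 2^(s/2), the average (1 + 2^(-s)) / 2 is cosh(ln h) / h. *)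
pose s := Num.min (10^-1) del.
have s0 : 0 < s by rewrite lt_min d0 invr_gt0 ltr0n.
have s1 : s <= 10^-1 by rewrite ge_min lexx.
have sd : s <= del by rewrite ge_min lexx orbT.
have l0 : 0 < ln 2 :> R by rewrite ln_gt0 // ltr1n.
have l1 := ln2_le1.
pose u := s * ln 2 / 2.
have u0 : 0 < u by rewrite /u !mulr_gt0 // invr_gt0.
have us : u <= s / 2 by rewrite /u; nra.
have u1 : u <= 1 / 20 by lra.
pose h := expR u.
have h0 : 0 < h := expR_gt0 _.
have hu : h * (1 - u) <= 1.
  have := expR_ge1Dx (- u); rewrite expRN -/h => le.
  have : h * (1 - u) <= h * h^-1 by rewrite ler_pM2l //.
  by rewrite mulfV ?gt_eqF.
have hub : h <= 1 + u + 2 * u ^+ 2.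
  have : h * (1 - u) <= (1 + u + 2 * u ^+ 2) * (1 - u).
    apply: le_trans hu _.
    have -> : (1 + u + 2 * u ^+ 2) * (1 - u) = 1 + u ^+ 2 * (1 - 2 * u) by ring.
    by rewrite lerDl mulr_ge0 ?sqr_ge0 //; lra.
  by rewrite ler_pM2r //; lra.
have hV : h^-1 <= 1 - u + u ^+ 2.
  have h1u : 1 + u <= h := expR_ge1Dx u.
  have : h^-1 <= (1 + u)^-1 by rewrite lef_pV2 ?posrE //; lra.
  move=> /le_trans; apply; rewrite -[leLHS]mul1r ler_pdivrMr; last by lra.
  have -> : (1 - u + u ^+ 2) * (1 + u) = 1 + u ^+ 3 by ring.
  by rewrite lerDl exprn_ge0 // ltW.
pose lam0 := (1 + decay s 2) / 2.
pose k := expR (beta * s * ln 2).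
have k0 : 0 < k := expR_gt0 _.
have dec2 : decay s 2 = h^-1 ^+ 2.
  by rewrite /decay /h -expRN expr2 -expRD; congr expR; rewrite /u; field.
(* h / k = exp (2 del u): this is the first-order gain due to beta < 1/2. *)
have kh : k * (1 + 2 * del * u) <= h.
  have -> : h = k * expR (2 * del * u).
    by rewrite /k /h -expRD; congr expR; rewrite /u /del; field.
  by rewrite ler_pM2l // expR_ge1Dx.
have kle : k <= h.
  by apply: le_trans kh; rewrite ler_peMr ?(ltW k0) // lerDl !mulr_ge0 //; lra.
have lam0k : lam0 * k < 1.
  have du : 0 < 1 + 2 * del * u by rewrite addr_gt0 // !mulr_gt0.
  rewrite -(ltr_pM2r du) mul1r -[lam0 * k * _]mulrA.
  apply: le_lt_trans (_ : lam0 * h < _).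
    by rewrite ler_wpM2l // /lam0 divr_ge0 // addr_ge0 // ltW ?decay_gt0.
  have -> : lam0 * h = (h + h^-1) / 2.
    by rewrite /lam0 dec2; field; rewrite gt_eqF.
  (* The excess of cosh u over 1 is of order u^2, and s <= del makes it smaller than the gain 2 del
     u. *)
  have : u ^+ 2 <= del * u / 2.
    have ud : u <= del / 2 by lra.
    rewrite -subr_ge0 (_ : _ - _ = u * (del / 2 - u)); last by ring.
    by rewrite mulr_ge0 ?subr_ge0 // ltW.
  nra.
(* From s <= 1/10 one has u <= 1/20, hence k <= 20/19. *)
have nine : 9 / 10 * k < 1.
  have : k * (1 - u) <= 1 by apply: le_trans hu; rewrite ler_pM2r //; lra.
  nra.
pose m := Num.max lam0 (9 / 10).
have mk : m * k < 1 by rewrite /m; case: (leP lam0).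
pose lam := (m + k^-1) / 2.
have mkV : m < k^-1 by rewrite -[ltRHS]mul1r ltr_pdivlMr.
have mlam : m < lam by rewrite /lam; lra.
have lam0m : lam0 <= m by rewrite le_max lexx.
have m9 : 9 / 10 <= m by rewrite le_max lexx orbT.
have lam00 : 0 < lam0 by rewrite /lam0 divr_gt0 // addr_gt0 ?decay_gt0.
(* Large enough for (1 + 1/K) lam0 <= lam; since s <= 1, (1 + 1/K)^s is at most 1 + 1/K. *)
pose K := Num.max 1 (lam0 / (lam - lam0)).
have K1 : 1 <= K by rewrite le_max lexx.
exists s, K, lam; split => //; first by lra.
  have x0 : 0 < 1 + K^-1 by rewrite addr_gt0 // invr_gt0; lra.
  have : decay s (1 + K^-1)^-1 <= 1 + K^-1.
    rewrite /decay lnV ?posrE // mulrN opprK -[leRHS]lnK ?posrE // ler_expR.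
    have : 0 <= ln (1 + K^-1) by rewrite ln_ge0 // lerDl invr_ge0; lra.
    nra.
  move=> hdec.
  have e : 1 + decay s 2 = 2 * lam0 by rewrite /lam0; field.
  rewrite e mulrCA ler_pM2l //.
  apply: le_trans (_ : (1 + K^-1) * lam0 <= _); first by rewrite ler_pM2r.
  have hK : lam0 / (lam - lam0) <= K by rewrite le_max lexx orbT.
  have : lam0 * K^-1 <= lam - lam0.
    rewrite ler_pdivrMr; last by lra.
    by rewrite -ler_pdivrMl 1?mulrC //; lra.
  rewrite mulrDl mul1r [_ * lam0]mulrC; lra.
rewrite -/k; have : lam < k^-1 by rewrite /lam; lra.
by rewrite -[X in _ < X -> _]mul1r ltr_pdivlMr.
Qed.

End Potential.

(** * Averaging the potential over all indices *)

Section Averaging.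
Context {R : realType}.
Variables a p : forall n, 'I_(2 ^ n) -> R.
Hypothesis a_ge0 : forall n i, 0 <= @a n i.
Hypothesis p_ge0 : forall n i, 0 <= @p n i.
Hypothesis a_even : forall n (j : 'I_(2 ^ n)), a (even_pos j) <= 2 * a j - a j ^+ 2.
Hypothesis a_odd : forall n (j : 'I_(2 ^ n)), a (odd_pos j) <= a j ^+ 2.
Hypothesis p_even : forall n (j : 'I_(2 ^ n)), p (even_pos j) <= p j ^+ 2.
Hypothesis p_odd : forall n (j : 'I_(2 ^ n)), p (odd_pos j) <= 2 * p j - p j ^+ 2.
Hypothesis init : forall i : 'I_(2 ^ 0), a i + p i <= 1.

(** For the odd child, 1 - (a^2 + 2p - p^2) = (1 - p)^2 - a^2 = (1 - p - a)(1 - p + a); the even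
    child is symmetric. *)
Lemma params_sum_le1 n (i : 'I_(2 ^ n)) : a i + p i <= 1.
Proof.
elim: n i => [|n IH] i; first exact: init.
rewrite (half_posP i); set j := half_pos i; have := IH j.
have := a_ge0 j; have := p_ge0 j; case: (odd i) => p0 a0 ap.
  have := a_odd j; have := p_odd j.
  have : 0 <= (1 - a j - p j) * (1 + a j - p j) by rewrite mulr_ge0 //; lra.
  nra.
have := a_even j; have := p_even j.
have : 0 <= (1 - a j - p j) * (1 + p j - a j) by rewrite mulr_ge0 //; lra.
nra.
Qed.

Section Contraction.
Variables s K lam : R.
Hypotheses (s_ge0 : 0 <= s) (K_ge1 : 1 <= K) (lam_gt : 9 / 10 < lam).
Hypothesis contract : decay s (1 + K^-1)^-1 * (1 + decay s 2) <= 2 * lam.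

(* Chosen so that 2 E + 9/5 D = 2 lam D for E = expR ((K + 1) / 2) and D the coefficient. *)
Definition sqrt_coef : R := expR ((K + 1) / 2) / (lam - 9 / 10).
Definition potential (q : R) : R := capped_decay s K q + sqrt_coef * Num.sqrt q.
Definition total_potential n : R := \sum_(i < 2 ^ n) potential (a i * p i).

Lemma sqrt_coef_ge0 : 0 <= sqrt_coef.
Proof. by rewrite divr_ge0 ?expR_ge0 // subr_ge0 ltW. Qed.

(** The decay part contracts by 2 lam up to an error in sqrt q. The square-root part has the factor
    9/5 < 2 lam, and this slack absorbs the error. *)
Lemma potential_step n (j : 'I_(2 ^ n)) :
  potential (a (even_pos j) * p (even_pos j)) +
  potential (a (odd_pos j) * p (odd_pos j)) <= 2 * lam * potential (a j * p j).
Proof.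
have a0 := a_ge0 j; have p0 := p_ge0 j; have ap := params_sum_le1 j.
set q := a j * p j; have q0 : 0 <= q by exact: mulr_ge0.
set qe := a (even_pos j) * _; set qo := a (odd_pos j) * _.
have he : 0 <= qe <= q * (p j * (2 - a j)).
  apply/andP; split; first by rewrite mulr_ge0 ?a_ge0 ?p_ge0.
  have -> : q * (p j * (2 - a j)) =
    (2 * a j - a j ^+ 2) * p j ^+ 2 by rewrite /q; ring.
  by apply: ler_pM; rewrite ?a_ge0 ?p_ge0 ?a_even ?a_odd ?p_even ?p_odd.
have ho : 0 <= qo <= q * (a j * (2 - p j)).
  apply/andP; split; first by rewrite mulr_ge0 ?a_ge0 ?p_ge0.
  have -> : q * (a j * (2 - p j)) =
    a j ^+ 2 * (2 * p j - p j ^+ 2) by rewrite /q; ring.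
  by apply: ler_pM; rewrite ?a_ge0 ?p_ge0 ?a_even ?a_odd ?p_even ?p_odd.
have h1 := capped_decay_step s_ge0 K_ge1 a0 p0 ap he ho.
have h2 := sqrt_step a0 p0 ap.
case/andP: he => _ he; case/andP: ho => _ ho.
have h3 : Num.sqrt qe + Num.sqrt qo <= 9 / 5 * Num.sqrt q.
  apply: le_trans (lerD (ler_wsqrtr he) (ler_wsqrtr ho)) _.
  by rewrite !(sqrtrM _ q0) -mulrDr mulrC ler_wpM2r ?sqrtr_ge0.
have eC : expR ((K + 1) / 2) = sqrt_coef * (lam - 9 / 10).
  by rewrite /sqrt_coef divfK // subr_eq0 gt_eqF.
have h4 := ler_wpM2l sqrt_coef_ge0 h3.
have h5 := ler_wpM2r (capped_decay_ge0 s K q) contract.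
rewrite /potential; move: h1 h4 h5; rewrite eC.
set x := capped_decay s K q; set y := Num.sqrt q; set c := sqrt_coef; lra.
Qed.

Lemma total_potential_le n :
  total_potential n <= (2 * lam) ^+ n * total_potential 0.
Proof.
have lam0 : 0 <= 2 * lam by have := lam_gt; lra.
elim: n => [|n IH]; first by rewrite expr0 mul1r.
rewrite /total_potential big_even_odd exprS -mulrA.
apply: le_trans (ler_wpM2l lam0 IH); rewrite mulr_sumr.
by apply: ler_sum => j _; exact: potential_step.
Qed.

(** The hypothesis bounds L by 2 ln 2 N^beta. Both L and the cap K are then at most 2 K N^beta, as
    ln 2 <= 1 <= K and N^beta >= 1. The exponential factor is N^(- beta s). *)
Lemma potential_ge_threshold (beta : R) n q : 0 < beta ->
  threshold n beta ^+ 2 <= q ->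
  decay s (2 * K) * expR (beta * s * ln 2) ^- n <= potential q.
Proof.
move=> b0; set t := threshold n beta => tq.
have t0 : 0 < t by rewrite powR_gt0.
apply: (@le_trans _ _ (capped_decay s K q)); last first.
  by rewrite lerDl mulr_ge0 ?sqrtr_ge0 ?sqrt_coef_ge0.
have K0 : 0 < K := lt_le_trans ltr01 K_ge1.
apply: le_trans (capped_decay_mono s_ge0 K0 (sqr_ge0 t) tq).
have Nb : (2 ^ n)%:R `^ beta = expR (beta * ln 2 *+ n) :> R.
  rewrite /powR pnatr_eq0 expn_eq0 /= natrX lnXn // mulrnAr.
  by [].
set B := (2 ^ n)%:R `^ beta in Nb *.
have B1 : 1 <= B.
  rewrite Nb -[leLHS]expR0 ler_expR mulrn_wge0 // mulr_ge0 ?ln_ge0 ?ler1n ?ltW //.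
have -> : expR (beta * s * ln 2) ^- n = decay s B.
  by rewrite /decay Nb expRK -expRM_natl -expRN -mulr_natl; congr expR; ring.
rewrite /capped_decay gt_eqF ?exprn_gt0 // -decayM; [|lra|lra].
apply: decay_anti => //; first by rewrite lt_max K0.
have -> : - ln (t ^+ 2) = 2 * ln 2 * B.
  rewrite /t /threshold expr2 lnM ?posrE ?powR_gt0 // ln_powR -/B; ring.
rewrite ge_max; apply/andP; split.
  have : 0 <= K * B by rewrite mulr_ge0 //; lra.
  have : 0 <= K * (B - 1) by rewrite mulr_ge0 ?subr_ge0 //; lra.
  nra.
rewrite ler_wpM2r //; first by lra.
have := K_ge1; have := @ln2_le1 R; lra.
Qed.

End Contraction.

Lemma bad_fraction_cvg0 (beta : R) : 0 < beta < 1 / 2 ->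
  #|[set i : 'I_(2 ^ n) | (threshold n beta <= a i) && (threshold n beta <= p i)]%SET|%:R
    / (2 ^ n)%:R @[n --> \oo] --> (0 : R).
Proof.
move=> hb; have [s [K [lam [s0 K1 l9 hc hl]]]] := potential_params hb.
have b0 : 0 < beta by case/andP: hb.
set k := expR (beta * s * ln 2) in hl.
have k0 : 0 < k := expR_gt0 _.
have d0 : 0 < decay s (2 * K) := decay_gt0 _ _.
pose c := total_potential s K lam 0 / decay s (2 * K).
(* The bound (2 lam)^n on the total potential, divided by the 2^n indices and by the lower bound of
   order k^(-n), leaves the ratio lam k < 1. *)
apply: (@squeeze_cvgr _ _ _ _ (fun=> 0) (geometric c (lam * k))).
- near=> n; rewrite divr_ge0 //=.
  set A := [set i | _]%SET.
  (* Markov's inequality: counted indices have at least this potential and the others at least 0. *)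
  have h : #|A|%:R * (decay s (2 * K) * k ^- n) <= total_potential s K lam n.
    rewrite -sum1_card natr_sum mulr_suml /total_potential big_mkcond /=.
    apply: ler_sum => i _; rewrite inE; case: ifPn => [/andP[ta tp]|_].
      rewrite mul1r; apply: potential_ge_threshold => //; first exact: ltW.
      by rewrite expr2 ler_pM // powR_ge0.
    rewrite addr_ge0 ?capped_decay_ge0 // mulr_ge0 ?sqrtr_ge0 //.
    exact: sqrt_coef_ge0.
  have h' := le_trans h (total_potential_le (ltW s0) K1 l9 hc n).
  rewrite ler_pdivrMr ?ltr0n ?expn_gt0 // /c.
  have dk : 0 < decay s (2 * K) * k ^- n by rewrite mulr_gt0 // invr_gt0 exprn_gt0.
  rewrite -(ler_pM2r dk); apply: le_trans h' _; rewrite le_eqVlt; apply/orP; left.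
  apply/eqP; rewrite natrX !exprMn; field.
  by rewrite !gt_eqF ?exprn_gt0.
- exact: cvg_cst.
- apply: cvg_geometric; rewrite ger0_norm //.
  by rewrite mulr_ge0 ?(ltW k0) //; lra.
Unshelve. all: by end_near.
Qed.

End Averaging.

(** * Amplitude and phase channels *)

Section Compression.
Context {C : numClosedFieldType}.

(** The map |j> -> |g j>. Partial traces are sums of compressions by such maps, which makes their
    positivity immediate. *)
Definition select_mx d D (g : 'I_d -> 'I_D) : 'M[C]_(D, d) :=
  \matrix_(a, j) (a == g j)%:R.

Lemma select_mxE d D (g : 'I_d -> 'I_D) (X : 'M[C]_D) i j :
  ((select_mx g)^t* *m X *m select_mx g) i j = X (g i) (g j).
Proof.
rewrite mxE (bigD1 (g j)) //= big1 ?addr0 => [|a ag]; last first.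
  by rewrite [select_mx g a j]mxE (negbTE ag) mulr0.
rewrite [select_mx g _ _]mxE eqxx mulr1 mxE (bigD1 (g i)) //= big1 ?addr0 => [|a ag].
  by rewrite !mxE rmorph_nat eqxx mul1r.
by rewrite !mxE rmorph_nat (negbTE ag) mul0r.
Qed.

Lemma dotD n (u v : 'cV[C]_n) :
  ((u + v)^t* *m (u + v)) 0 0 =
  (u^t* *m u) 0 0 + (u^t* *m v) 0 0 + ((v^t* *m u) 0 0 + (v^t* *m v) 0 0).
Proof.
have -> : (u + v)^t* = u^t* + v^t* by rewrite linearD /= map_mxD.
have addE (A B : 'M[C]_1) : (A + B) 0 0 = A 0 0 + B 0 0 by rewrite mxE.
by rewrite mulmxDl !mulmxDr !addE.
Qed.

Lemma dot_scale n (c : C) (v : 'cV[C]_n) :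
  ((c *: v)^t* *m (c *: v)) 0 0 = c^* * c * (v^t* *m v) 0 0.
Proof.
have -> : (c *: v)^t* = c^* *: v^t* by apply/matrixP=> i j; rewrite !mxE rmorphM.
by rewrite -scalemxAl -scalemxAr scalerA mxE.
Qed.

Lemma isometry_dot m n (V : 'M[C]_(m, n)) (v : 'cV[C]_n) :
  V^t* *m V = 1%:M -> (V *m v)^t* *m (V *m v) = v^t* *m v.
Proof.
by move=> h; rewrite ctrmxM mulmxA -[_ *m V^t* *m V]mulmxA h mulmx1.
Qed.

End Compression.

Section OutputStates.
Context {R : realType}.
Local Notation C := R[i].

Lemma ptrace2_select d1 d2 (X : 'M[C]_(d1 * d2)) :
  ptrace2 X = \sum_k (select_mx (fun j => mxtens_index (j, k)))^t* *m X *m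
    select_mx (fun j => mxtens_index (j, k)).
Proof.
apply/matrixP=> i j; rewrite mxE summxE; apply: eq_bigr => k _.
by rewrite select_mxE.
Qed.

Lemma psdmx_ptrace2 d1 d2 (X : 'M[C]_(d1 * d2)) : psdmx X -> psdmx (ptrace2 X).
Proof. by move=> hX; rewrite ptrace2_select; apply: psd_sum => k; apply: psd_conj. Qed.

Lemma mxtrace_ptrace2 d1 d2 (X : 'M[C]_(d1 * d2)) : \tr (ptrace2 X) = \tr X.
Proof.
transitivity (\sum_(i < d1) \sum_(k < d2) X (mxtens_index (i, k)) (mxtens_index (i, k))).
  by apply: eq_bigr => i _; rewrite mxE.
rewrite pair_bigA /mxtrace [RHS](reindex (@mxtens_index d1 d2)) /=.
  by apply: eq_bigr => -[].
exact/onW_bij/(Bijective (@mxtens_indexK d1 d2) (@mxtens_unindexK d1 d2)).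
Qed.

Lemma mxtrace_ketbra d (v : 'cV[C]_d) : \tr (ketbra v) = (v^t* *m v) 0 0.
Proof. by rewrite /ketbra mxtrace_mulC trace_mx11. Qed.

Lemma psdmx_ketbra d (v : 'cV[C]_d) : psdmx (ketbra v).
Proof. by rewrite /ketbra -{1}[v]trmxCK; exact: psd_gram. Qed.

Variables dB dE dS1 dS2 : nat.
Local Notation phase_index := (@phase_index dB dE dS1 dS2).

(** Inverse of [phase_index]: it shows that summing over B C S1 S2 and then over E exhausts the
    whole basis. *)
Definition phase_unindex (a : 'I_(2 * (dB * dE * dS2 * dS1))) :
    'I_(dB * (2 * (dS1 * dS2))) * 'I_dE :=
  let: (c, r) := mxtens_unindex a in
  let: (r', s1) := mxtens_unindex r in
  let: (be, s2) := mxtens_unindex r' in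
  let: (b, e) := mxtens_unindex be in
  (mxtens_index (b, mxtens_index (c, mxtens_index (s1, s2))), e).

Lemma phase_indexE b c s1 s2 e :
  phase_index (mxtens_index (b, mxtens_index (c, mxtens_index (s1, s2)))) e =
  mxtens_index (c, mxtens_index (mxtens_index (mxtens_index (b, e), s2), s1)).
Proof. by unfold Defs.phase_index; rewrite !mxtens_indexK. Qed.

Lemma phase_unindexE c b e s2 s1 :
  phase_unindex
    (mxtens_index (c, mxtens_index (mxtens_index (mxtens_index (b, e), s2), s1))) =
  (mxtens_index (b, mxtens_index (c, mxtens_index (s1, s2))), e).
Proof. by unfold phase_unindex; rewrite !mxtens_indexK. Qed.

Lemma phase_index_bij : bijective (fun q => phase_index q.1 q.2).
Proof.
exists phase_unindex => [[k e]|a].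
  case: (mxtens_indexP k) => b r; case: (mxtens_indexP r) => c s.
  case: (mxtens_indexP s) => s1 s2.
  by rewrite [X in phase_unindex X]phase_indexE phase_unindexE.
case: (mxtens_indexP a) => c r; case: (mxtens_indexP r) => r' s1.
case: (mxtens_indexP r') => be s2; case: (mxtens_indexP be) => b e.
by rewrite phase_unindexE phase_indexE.
Qed.

Lemma psdmx_ptraceE (X : 'M[C]_(2 * (dB * dE * dS2 * dS1))) :
  psdmx X -> psdmx (ptraceE X).
Proof.
move=> hX; have -> : ptraceE X = \sum_e (select_mx (phase_index^~ e))^t* *m X *m
    select_mx (phase_index^~ e).
  by apply/matrixP=> i j; rewrite mxE summxE; apply: eq_bigr => e _; rewrite select_mxE.
by apply: psd_sum => e; apply: psd_conj.
Qed.

Lemma mxtrace_ptraceE (X : 'M[C]_(2 * (dB * dE * dS2 * dS1))) :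
  \tr (ptraceE X) = \tr X.
Proof.
transitivity (\sum_i \sum_e X (phase_index i e) (phase_index i e)).
  by apply: eq_bigr => i _; rewrite mxE.
by rewrite pair_bigA /mxtrace [RHS](reindex _ (onW_bij _ phase_index_bij)).
Qed.

Lemma pauliZ_isometry k : ((@pauliZ R) ^+ k)^t* *m (@pauliZ R) ^+ k = 1%:M.
Proof.
have Z1 : (@pauliZ R)^t* *m @pauliZ R = 1%:M.
  rewrite /pauliZ tr_diag_mx map_diag_mx mulmx_diag; apply/matrixP=> i j.
  rewrite !mxE; case: eqP => [->|//] /=.
  rewrite [X in X * _](_ : _ = (-1) ^+ j); last first.
    by rewrite rmorphXn rmorphN1.
  by rewrite -exprMn mulrNN mulr1 expr1n.
elim: k => [|k IH]; first by rewrite expr0 ctrmx1 mulmx1.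
rewrite exprS ctrmxM mulmxA -[_ *m _^t* *m _]mulmxA Z1 mulmx1.
exact: IH.
Qed.

Lemma dot_tens m n (u u' : 'cV[C]_m) (v v' : 'cV[C]_n) :
  ((u *t v)^t* *m (u' *t v')) 0 0 = (u^t* *m u') 0 0 * (v^t* *m v') 0 0.
Proof. by rewrite ctrmx_tens tensmx_mul [LHS]mxE !ord1. Qed.

(** Orthogonality of |0> and |1> on C kills the cross terms, whatever the overlap of the two
    purifications. *)
Lemma phi_state_norm (psi : 'F_2 -> 'cV[C]_(2 * dS1)) :
  (forall z, ((psi z)^t* *m psi z) 0 0 = 1) ->
  ((phi_state psi)^t* *m phi_state psi) 0 0 = 1.
Proof.
move=> h; rewrite /phi_state sumF2 dot_scale.
set u := ket 0 *t psi 0; set v := ket 1 *t psi 1.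
have e (x y : 'F_2) : ((ket x *t psi x)^t* *m (ket y *t psi y)) 0 0 =
    (x == y)%:R * ((psi x)^t* *m psi y) 0 0.
  apply: etrans (dot_tens _ _ _ _) _; congr (_ * _).
  rewrite /ket ctrmx_delta; case: (eqVneq x y) => [->|xy].
    by rewrite mul_delta_mx mxE !eqxx.
  by rewrite mul_delta_mx_0 // mxE.
have huu : (u^t* *m u) 0 0 = 1 by apply: etrans (e 0 0) _; rewrite eqxx mul1r h.
have hvv : (v^t* *m v) 0 0 = 1 by apply: etrans (e 1 1) _; rewrite eqxx mul1r h.
have huv : (u^t* *m v) 0 0 = 0 by apply: etrans (e 0 1) _; rewrite mul0r.
have hvu : (v^t* *m u) 0 0 = 0 by apply: etrans (e 1 0) _; rewrite mul0r.
have huv2 : ((u + v)^t* *m (u + v)) 0 0 = 2.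
  apply: etrans (dotD u v) _; apply: etrans (congr2 _ (congr2 _ huu huv) (congr2 _ hvu hvv)) _.
  by rewrite addr0 add0r.
apply: etrans (congr1 _ huv2) _.
have c0 : 0 <= (sqrtC 2 : C)^-1 by rewrite invr_ge0 sqrtC_ge0 ler0n.
rewrite geC0_conj // -expr2 exprVn sqrtCK mulVf // pnatr_eq0.
Qed.

End OutputStates.

(** Positivity is read off the isometric extension, a conjugation by U followed by a partial trace;
    the trace comes from trace preservation. *)
Lemma amplitude_channel_state (R : realType) (dB dE dS2 : nat)
    (T : 'M[R[i]]_2 -> 'M[R[i]]_(dB * dE)) (U : 'M[R[i]]_(dB * dE * dS2, 2))
    (rho : 'F_2 -> 'M[R[i]]_2) :
  isometric_extension U T -> trace_preserving T -> (forall z, density (rho z)) ->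
  forall z, density (amplitude_channel T rho z).
Proof.
move=> [_ hU] hT hrho z; have [hpsd htr] := hrho z; split.
  apply: psdmx_ptrace2; rewrite hU; apply: psdmx_ptrace2.
  rewrite -{1}[U]trmxCK; exact: psd_conj.
by rewrite mxtrace_ptrace2 hT.
Qed.

(** Z^x and U act as isometries on a unit vector, and tracing out E preserves positivity and
    trace. *)
Lemma phase_channel_state (R : realType) (dB dE dS1 dS2 : nat)
    (T : 'M[R[i]]_2 -> 'M[R[i]]_(dB * dE)) (U : 'M[R[i]]_(dB * dE * dS2, 2))
    (rho : 'F_2 -> 'M[R[i]]_2) (psi : 'F_2 -> 'cV[R[i]]_(2 * dS1)) :
  isometric_extension U T -> (forall z, density (rho z)) ->
  (forall z, purification (psi z) (rho z)) ->
  forall x, density (phase_channel U psi x).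
Proof.
move=> [hU _] hrho hpsi x; split.
  by apply: psdmx_ptraceE; apply: psdmx_ketbra.
rewrite mxtrace_ptraceE mxtrace_ketbra !isometry_dot.
- apply: phi_state_norm => z; have [_ <-] := hrho z.
  by rewrite -mxtrace_ketbra -(hpsi z) mxtrace_ptrace2.
- by rewrite ctrmx_tens tensmx_mul pauliZ_isometry ctrmx1 mulmx1 tensmx11.
by rewrite !ctrmx_tens !tensmx_mul hU !ctrmx1 !mulmx1 !tensmx11.
Qed.

(** One Fuchs-Caves measurement of the single-use channel serves every block length: it attains the
    fidelity at N = 1 and bounds it from above for larger N. From here on only the classical channel
    w matters. *)
Lemma single_letter_measurement (R : realType) d (W : @cqchannel R d) :
  (forall x, density (W x)) ->
  exists w : 'F_2 -> 'I_d -> R,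
    [/\ forall x y, 0 <= w x y, forall x, \sum_y w x y <= 1,
        forall i, @bhatt R _ w 0 i = Num.sqrt (fidelity W),
        forall n (i : 'I_(2 ^ n)),
          Num.sqrt (fidelity (synth_amplitude W i)) <= bhatt w i &
        forall n (i : 'I_(2 ^ n)),
          Num.sqrt (fidelity (synth_phase W i)) <= bhatt w (rev_ord i)].
Proof.
move=> hW; have hpsd x : psdmx (W x) by case: (hW x).
have [b hb e] := trnorm_attained (hpsd 0) (hpsd 1).
exists (measured W b); split.
- by move=> x y; apply: expect_ge0.
- by move=> x; rewrite /measured sum_expect //; case: (hW x) => _ ->.
- by move=> i; rewrite bhatt_init sqrt_fidelity.
- by move=> n i; apply: sqrt_fidelity_amplitude_le.
by move=> n i; apply: sqrt_fidelity_phase_le.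
Qed.

(** Mirroring exchanges even and odd positions, which is why amplitude and phase parameters take
    opposite steps. *)
Lemma rev_even_pos n (j : 'I_(2 ^ n)) : rev_ord (even_pos j) = odd_pos (rev_ord j).
Proof. by apply: val_inj => /=; have := ltn_ord j; rewrite expnS; lia. Qed.

Lemma rev_odd_pos n (j : 'I_(2 ^ n)) : rev_ord (odd_pos j) = even_pos (rev_ord j).
Proof. by apply: val_inj => /=; have := ltn_ord j; rewrite expnS; lia. Qed.

(** * From the classical parameters to the secret key rate *)

Unset Implicit Arguments.

Theorem theorem3 (R : realType) (dB dE dS1 dS2 : nat)
    (T : {linear 'M[R[i]]_2 -> 'M[R[i]]_(dB * dE)})
    (hT_cp : completely_positive T) (hT_tp : trace_preserving T)
    (U : 'M[R[i]]_(dB * dE * dS2, 2)) (hU : isometric_extension U T)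
    (rho : 'F_2 -> 'M[R[i]]_2) (hrho : forall z, density (rho z))
    (psi : 'F_2 -> 'cV[R[i]]_(2 * dS1))
    (hpsi : forall z, purification (psi z) (rho z))
    (beta : R) (hbeta : 0 < beta < 1 / 2)
    (hF : Num.sqrt (fidelity (amplitude_channel T rho))
          + Num.sqrt (fidelity (phase_channel U psi)) < 1) :
  secret_key_rate (amplitude_channel T rho) (phase_channel U psi) beta n
    @[n --> \oo] --> (0 : R).
Proof.
have [wA [wA0 wA1 iA hA _]] :=
  single_letter_measurement (amplitude_channel_state hU hT_tp hrho).
have [wP [wP0 wP1 iP _ hP]] :=
  single_letter_measurement (phase_channel_state hU hrho hpsi).
pose a n (i : 'I_(2 ^ n)) := bhatt wA i.
(* Mirrored, so that [a] and [p] refer to the same input of the code. *)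
pose p n (i : 'I_(2 ^ n)) := bhatt wP (rev_ord i).
apply: squeeze_cvgr (cvg_cst 0) (@bad_fraction_cvg0 R a p _ _ _ _ _ _ _ beta hbeta).
- near=> n; rewrite divr_ge0 //=.
  rewrite ler_wpM2r ?invr_ge0 // ler_nat subset_leq_card //.
  (* A secret-key index has both fidelities at or above the threshold, hence both classical
     parameters as well. *)
  apply/fintype.subsetP => i; rewrite !inE -!leNgt => /andP[tA tP].
  by rewrite (le_trans tA (hA _ _)) (le_trans tP (hP _ _)).
- by move=> n i; apply: bhatt_ge0.
- by move=> n i; apply: bhatt_ge0.
- by move=> n j; apply: bhatt_even.
- by move=> n j; rewrite /a bhatt_odd.
- by move=> n j; rewrite /p rev_even_pos bhatt_odd.
- by move=> n j; rewrite /p rev_odd_pos bhatt_even.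
by move=> i; rewrite /a /p iA iP ltW.
Unshelve. all: by end_near.
Qed.
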